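(* Let $n\ge2$, let $U \subset \mathbb{R}^n$ be a bounded Lipschitz domain, and let $\sigma \in \mathcal{M}(\partial U)$. Then there exists a Cauchy flux $\mathcal{F}$ on $\mathbb{R}^n$ (with respect to some signed measure $\mu$ on $\mathbb{R}^n$ and some non-negative $m\in L^1(\mathbb{R}^n)$) for which $U \in \mathcal{O}_{m}$ and $$\mathcal{F}_{U}(S) = \sigma(S) \quad\text{for all Borel subsets } S \subset \partial U.$$
   Context: $\mathcal{M}(\partial U)$ denotes the finite signed Radon measures on $\partial U$; $B_\varepsilon(\partial U)=\{x:\operatorname{dist}(x,\partial U)<\varepsilon\}$; $\mathcal{L}^n$ is Lebesgue measure, $\llcorner$ denotes restriction. Let $\Omega\subset\mathbb{R}^n$ be open. For non-negative $m\in L^1(\Omega)$, $$\mathcal{O}_m=\Big\{U\subset\Omega: U\text{ open},\ \liminf_{\varepsilon\downarrow0}\frac1\varepsilon\int_{U\cap B_\varepsilon(\partial U)}m\,\mathrm{d}x<\infty\Big\}.$$ Cauchy flux (in the sense of Chen–Irving–Torres, for integrable fields). Let $\mu$ be a signed measure on $\Omega$ and $m\in L^1(\Omega)$ non-negative. A Cauchy flux on $\Omega$ with respect to $\mu$ and $m$ is a set function $\mathcal{F}$ defined on pairs $(S,U)$ with $U\in\mathcal{O}_m$ and $S\subset\partial U$ any Borel set, written $\mathcal{F}_U(S)$, such that: (a) if $U,V\in\mathcal{O}_m$ and $A\subset\Omega$ is open with $A\cap U=A\cap V$, then $\mathcal{F}_U(A\cap\partial U)=\mathcal{F}_V(A\cap\partial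 V)$; (b) if $U\in\mathcal{O}_m$ and $S_1,S_2\subset\partial U$ are disjoint Borel subsets, then $\mathcal{F}_U(S_1\cup S_2)=\mathcal{F}_U(S_1)+\mathcal{F}_U(S_2)$; (c) the balance law $\mathcal{F}_U(\partial U)=\mu(U)$ holds for all $U\in\mathcal{O}_m$; (d) for any $U\in\mathcal{O}_m$ and any Borel set $S\subset\partial U$, $|\mathcal{F}_U(S)|\le m_U^{n-1}(S)$ for any limiting measure $m_U^{n-1}$, i.e. any measure arising as a weak$^*$ limit $\frac1{\varepsilon_k}m\,\mathcal{L}^n\llcorner(U\cap B_{\varepsilon_k}(\partial U))\to m_U^{n-1}$ along some sequence $\varepsilon_k\downarrow0$. Here $\Omega=\mathbb{R}^n$. *)

(* Defs.v *)
From HB Require Import structures.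
From mathcomp Require Import all_boot all_order all_algebra.
From mathcomp Require Import all_classical all_reals all_analysis.
From mathcomp Require Import measurable_realfun.

Set Implicit Arguments.
Unset Strict Implicit.
Unset Printing Implicit Defensive.

Import Order.TTheory GRing.Theory Num.Theory.
Import numFieldNormedType.Exports.

Local Open Scope classical_set_scope.
Local Open Scope ring_scope.

(* 'M[R]_(m, n) carries its Borel sigma-algebra, generated by the open sets. *)
HB.instance Definition _ (R : realType) (m n : nat) :=
  @isMeasurable.Build (sigma_display (@open 'M[R]_(m, n))) 'M[R]_(m, n)
    <<s @open 'M[R]_(m, n) >> (@sigma_algebra0 _ setT _)
    (@sigma_algebraC _ _) (@sigma_algebra_bigcup _ setT _).

Section lebesgue_rV.
Context (R : realType).

Lemma open_measurable_mx m n (A : set 'M[R]_(m, n)) : open A -> measurable A.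
Proof. exact: sub_sigma_algebra. Qed.

Lemma open_rV_bigcup_ball n (O : set 'rV[R]_n) : open O ->
  O = \bigcup_(p : 'rV[rat]_n * rat)
        (if `[< ball (map_mx ratr p.1 : 'rV[R]_n) (ratr p.2) `<=` O >]
         then ball (map_mx ratr p.1 : 'rV[R]_n) (ratr p.2) else set0).
Proof.
move=> oO; apply/seteqP; split=> [x Ox|x [[q r] _] /=]; last first.
  by case: asboolP => // + xB; apply.
have [e /= e0 xeO] : \forall e \near 0^'+, ball x e `<=` O.
  exact: open_subball.
have e2 : 0 < e / 2 by rewrite divr_gt0.
have e4 : 0 < e / 2 / 2 by rewrite divr_gt0.
have {}xeO : ball x (e / 2) `<=` O.
  apply: xeO => //=; rewrite sub0r normrN gtr0_norm//.
  by rewrite ltr_pdivrMr// ltr_pMr// ltr1n.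
have [r] : exists r : rat, ratr r \in `]0, (e / 2 / 2)[ by apply: rat_in_itvoo.
rewrite in_itv/= => /andP[r0 re].
have qE i : {q : rat | `|x ord0 i - ratr q| < ratr r}.
  apply: cid.
  have /rat_in_itvoo[q] : x ord0 i - ratr r < x ord0 i + ratr r.
    by rewrite ltrD2l gtrN.
  rewrite in_itv/= => /andP[q1 q2]; exists q.
  by rewrite distrC ltr_distl q1 q2.
exists (\row_i sval (qE i), r) => //=.
have xq : ball (map_mx ratr (\row_i sval (qE i)) : 'rV[R]_n) (ratr r) x.
  by split => // i j; rewrite !mxE (ord1 i) /ball/= distrC; exact: svalP (qE j).
case: asboolP => // -[]; move=> y [_ yq]; apply: xeO; split=> // i j.
apply: (@le_ball _ _ _ (ratr r + ratr r)); first by rewrite [leRHS]splitr lerD// ltW.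
apply: (ball_triangle (y := (map_mx ratr (\row_i sval (qE i)) : 'rV[R]_n) i j)).
  by apply: ball_sym; apply: (xq.2 i j).
exact: yq.
Qed.

(* (t, v) |-> the vector with first coordinate t followed by v *)
Definition rV_cons n (p : measurableTypeR R * 'rV[R]_n) : 'rV[R]_(1 + n) :=
  row_mx (p.1 : R)%:M p.2.

Lemma rV_cons0 n (p : measurableTypeR R * 'rV[R]_n) :
  rV_cons p ord0 ord0 = p.1.
Proof.
by rewrite /rV_cons mxE; case: splitP => // k _; rewrite (ord1 k) mxE eqxx mulr1n.
Qed.

Lemma rV_consS n (p : measurableTypeR R * 'rV[R]_n) i :
  rV_cons p ord0 (lift ord0 i) = p.2 ord0 i.
Proof.
rewrite /rV_cons mxE; case: splitP => k; first by rewrite (ord1 k).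
by rewrite lift0 add1n => -[] ik; congr (p.2 _ _); exact/val_inj.
Qed.

Lemma measurable_rV_cons n : measurable_fun setT (@rV_cons n).
Proof.
apply: (@measurability _ _ _ _ _ _ (@open 'rV[R]_(1 + n))) => //.
move=> _ [V oV <-]; rewrite setTI.
rewrite (open_rV_bigcup_ball oV) preimage_bigcup.
apply: countable_bigcupT_measurable; first exact: countableP.
move=> [q r]; case: ifPn => _; last first.
  by rewrite preimage_set0.
rewrite (_ : _ @^-1` _ =
  (ball (ratr (q ord0 (lshift n ord0)) : R) (ratr r) : set (measurableTypeR R))
  `*` ball (map_mx ratr (rsubmx q) : 'rV[R]_n) (ratr r)).
  apply: measurableX.
    by apply: open_measurable; exact: ball_open.
  by apply: open_measurable_mx; exact: ball_open.
apply/seteqP; split => [[t v] [r0 qr]|[t v] [/= tr [r0 vr]]].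
  split => /=.
    by have := qr ord0 (lshift n ord0); rewrite /rV_cons row_mxEl !mxE.
  split => // i j; have := qr i (rshift 1 j).
  by rewrite /rV_cons row_mxEr !mxE.
split => // i j; rewrite /rV_cons !mxE (ord1 i); case: splitP => k jk.
  rewrite (ord1 k) mxE eqxx mulr1n (_ : j = lshift n ord0)//.
  by apply/val_inj; rewrite /= jk (ord1 k).
have := vr ord0 k; rewrite !mxE (_ : rshift 1 k = j)//.
by apply/val_inj; rewrite /= -jk.
Qed.

Section lebesgue_rV_succ.
Local Open Scope ereal_scope.
Variables (n : nat) (mu : {sigma_finite_measure set 'rV[R]_n -> \bar R}).

Definition lebesgue_rV_succ : set 'rV[R]_(1 + n) -> \bar R :=
  pushforward (lebesgue_measure \x mu) (@rV_cons n).

Let measurable_preimage A : measurable A -> measurable (@rV_cons n @^-1` A).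
Proof. by move=> mA; rewrite -[X in measurable X]setTI; exact: measurable_rV_cons. Qed.

Let succ0 : lebesgue_rV_succ set0 = 0.
Proof. by rewrite /lebesgue_rV_succ /pushforward preimage_set0 measure0. Qed.

Let succ_ge0 A : 0 <= lebesgue_rV_succ A.
Proof. exact: (measure_ge0 (lebesgue_measure \x mu)). Qed.

Let succ_sigma_additive : semi_sigma_additive lebesgue_rV_succ.
Proof.
move=> F mF tF mUF; rewrite /lebesgue_rV_succ /pushforward preimage_bigcup.
apply: measure_semi_sigma_additive.
- by move=> k; exact: measurable_preimage.
- apply/trivIsetP => /= i j _ _ ij; rewrite -preimage_setI.
  by move/trivIsetP : tF => /(_ _ _ _ _ ij) ->//; rewrite preimage_set0.
- by rewrite -preimage_bigcup; exact: measurable_preimage.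
Qed.

HB.instance Definition _ := isMeasure.Build _ _ _ lebesgue_rV_succ
  succ0 succ_ge0 succ_sigma_additive.

Let succ_sigma_finite : sigma_finite setT lebesgue_rV_succ.
Proof.
have /sigma_finiteP[F [FT ndF Foo]] := sigma_finiteT (@lebesgue_measure R).
have /sigma_finiteP[G [GT ndG Goo]] := sigma_finiteT mu.
pose g (x : 'rV[R]_(1 + n)) : measurableTypeR R * 'rV[R]_n :=
  (x ord0 (lshift n ord0), rsubmx x).
have gK : cancel (@rV_cons n) g.
  move=> [t v]; rewrite /g /rV_cons row_mxKr; congr (_, _).
  by rewrite row_mxEl mxE eqxx mulr1n.
have mg : measurable_fun setT g.
  apply: measurable_fun_pair.
    apply: (measurability _ (RGenOpens.measurableE R)) => _ [_ [a [b ->]] <-].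
    rewrite setTI; apply: open_measurable_mx; apply: open_comp => //.
    by move=> x _; exact: coord_continuous.
  apply: (@measurability _ _ _ _ _ _ (@open 'rV[R]_n)) => //.
  move=> _ [V oV <-]; rewrite setTI; apply: open_measurable_mx.
  by apply: open_comp => // x _; exact: continuous_rsubmx.
exists (fun k => g @^-1` (F k `*` G k)).
  apply/seteqP; split=> // x _.
  have [i _ Fi] : (\bigcup_i F i) (g x).1 by rewrite -FT.
  have [j _ Gj] : (\bigcup_i G i) (g x).2 by rewrite -GT.
  exists (maxn i j) => //; split.
    by move: (g x).1 Fi; exact/subsetPset/ndF/leq_maxl.
  by move: (g x).2 Gj; exact/subsetPset/ndG/leq_maxr.
move=> k; have [mF Fk] := Foo k; have [mG Gk] := Goo k; split.
  by rewrite -[X in measurable X]setTI; apply: mg => //; exact: measurableX.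
rewrite /lebesgue_rV_succ /pushforward -comp_preimage (_ : g \o _ = id).
  rewrite preimage_id [ltLHS](product_measure1E _ mu)//.
  by rewrite lte_mul_pinfty// ge0_fin_numE.
by apply/funext => x /=; rewrite gK.
Qed.

HB.instance Definition _ := Measure_isSigmaFinite.Build _ _ _ lebesgue_rV_succ
  succ_sigma_finite.

End lebesgue_rV_succ.

(* n-dimensional Lebesgue measure, as an iterated product of lebesgue_measure *)
Fixpoint lebesgue_rV n : {sigma_finite_measure set 'rV[R]_n -> \bar R} :=
  match n with
  | 0 => [the {sigma_finite_measure set 'rV[R]_0 -> \bar R} of
           \d_ (0 : 'rV[R]_0)]
  | n.+1 => [the {sigma_finite_measure set 'rV[R]_(1 + n) -> \bar R} of
              lebesgue_rV_succ (lebesgue_rV n)]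
  end.

Lemma lebesgue_rV_box n (A : 'I_n -> set (measurableTypeR R)) :
  (forall i, measurable (A i)) ->
  measurable [set x : 'rV[R]_n | forall i, A i (x ord0 i)] /\
  lebesgue_rV n [set x | forall i, A i (x ord0 i)] =
  (\prod_(i < n) lebesgue_measure (A i))%E.
Proof.
elim: n A => [|n IH] A mA.
  rewrite big_ord0; split; last by rewrite [LHS]diracE mem_set// => -[].
  by rewrite (_ : mkset _ = setT)//; apply/seteqP; split => // x _ [].
split.
  rewrite [X in measurable X](_ : _ = \bigcap_(i : 'I_n.+1)
      (fun x : 'rV[R]_n.+1 => x ord0 i : measurableTypeR R) @^-1` A i); last first.
    by apply/seteqP; split => x /= Ax i; [move=> _|]; exact: Ax.
  apply: fin_bigcap_measurable => // i _; rewrite -[X in measurable X]setTI.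
  have mi : measurable_fun setT (fun x : 'rV[R]_n.+1 => x ord0 i : measurableTypeR R).
    apply: (measurability _ (RGenOpens.measurableE R)) => _ [_ [a [b ->]] <-].
    rewrite setTI; apply: open_measurable_mx; apply: open_comp => //.
    by move=> x _; exact: coord_continuous.
  exact: mi.
have [mB BE] := IH (fun i => A (lift ord0 i)) (fun i => mA _).
rewrite big_ord_recl -BE -(product_measure1E _ (lebesgue_rV n))//.
rewrite [LHS]/= /lebesgue_rV_succ /pushforward; congr (_ _).
apply/seteqP; split=> [[t v] /= H|[t v] [/= At Av] i].
  by split => [|i]; [have := H ord0; rewrite rV_cons0|
                     have := H (lift ord0 i); rewrite rV_consS].
by case: (unliftP ord0 i) => [j|] ->; rewrite ?rV_consS ?rV_cons0//; exact: Av.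
Qed.

End lebesgue_rV.

Section cauchy_flux.
Context (R : realType) (n : nat).
Local Notation V := 'rV[R]_n.
Implicit Types (A S U : set V) (x y : V) (m : V -> R).

(* The library norm on 'rV[R]_n is the sup norm, hence these. *)
Definition eucl_norm x : R := Num.sqrt (\sum_(i < n) x ord0 i ^+ 2).

Definition eucl_dist x A : \bar R :=
  ereal_inf [set (eucl_norm (x - y))%:E | y in A].

(* The open e-neighborhood of A; it is empty when A is, ereal_inf set0 being
   +oo. *)
Definition tube (e : R) A : set V := [set x | (eucl_dist x A < e%:E)%E].

Definition boundary A : set V := closure A `\` A°.

(* Near each boundary point, U is the strict epigraph of a Lipschitz function
   of n - 1 of the coordinates, in an orthonormal frame (the matrix Q) and
   after choosing which coordinate i is the vertical one; U need not be
   connected. *)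
Definition bounded_lipschitz_domain U :=
  [/\ open U, bounded_set U &
    forall x, boundary U x ->
      exists (Q : 'M[R]_n) (i : 'I_n) (g : 'rV[R]_n.-1 -> R) (r : R),
        [/\ Q *m Q^T = 1%:M, lipschitz g, 0 < r &
          forall y, eucl_norm (y - x) < r ->
            (U y <-> g (col' i (y *m Q)) < (y *m Q) ord0 i)]].

(* (1/e) \int f over the inner layer of U of width e: the total mass of
   (1/e) f L^n restricted to that layer. *)
Definition layer_integral U (e : R) (f : V -> R) : \bar R :=
  ((e^-1)%:E *
   \int[lebesgue_rV R n]_(x in U `&` tube e (boundary U)) (f x)%:E)%E.

(* the class O_m for Omega = R^n *)
Definition admissible m : set (set V) :=
  [set U | open U /\ (limf_einf (fun e => layer_integral U e m) 0^'+ < +oo)%E].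

(* nu is a Radon measure which is the weak-star limit (tested against C_c) of
   (1/e_k) m L^n restricted to the inner layer of U of width e_k, for some
   e_k tending to 0 from the right. *)
Definition limiting_measure m U (nu : {measure set V -> \bar R}) :=
  (forall K : set V, compact K -> (nu K < +oo)%E) /\
  exists2 e : R^nat, e @ \oo --> 0^'+ &
    forall phi : V -> R, continuous phi ->
      compact (closure [set x | phi x != 0]) ->
      layer_integral U (e k) (fun x => phi x * m x) @[k --> \oo] -->
        (\int[nu]_x (phi x)%:E)%E.

(* F U S is the flux through S; it is only meaningful for U in the class
   [admissible m] and S a Borel subset of the boundary of U. *)
Record cauchy_flux (mu : {charge set V -> \bar R}) m
    (F : set V -> set V -> R) : Prop := CauchyFlux {
  cauchy_flux_local : forall U W A,
    admissible m U -> admissible m W -> open A -> A `&` U = A `&` W ->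
    F U (A `&` boundary U) = F W (A `&` boundary W) ;
  cauchy_flux_additive : forall U S1 S2, admissible m U ->
    measurable S1 -> S1 `<=` boundary U ->
    measurable S2 -> S2 `<=` boundary U ->
    S1 `&` S2 = set0 -> F U (S1 `|` S2) = F U S1 + F U S2 ;
  cauchy_flux_balance : forall U, admissible m U ->
    (F U (boundary U))%:E = mu U ;
  cauchy_flux_bound : forall U S (nu : {measure set V -> \bar R}),
    admissible m U -> measurable S -> S `<=` boundary U ->
    limiting_measure m U nu -> (`|F U S|%:E <= nu S)%E
}.

End cauchy_flux.

(* Main.v *)
Require Import Defs.
From HB Require Import structures.
From mathcomp Require Import all_boot all_order all_algebra.
From mathcomp Require Import all_classical all_reals all_analysis.
From mathcomp Require Import measurable_realfun lra ring.
Import Order.TTheory GRing.Theory Num.Theory.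
Import numFieldNormedType.Exports.
Local Open Scope classical_set_scope.
Local Open Scope ring_scope.
Set Implicit Arguments.
Unset Strict Implicit.
Unset Printing Implicit Defensive.

(** The flux is carried by random straight segments. Since U is Lipschitz and its
    boundary compact, every boundary point x has a cone of directions pointing into
    U, with a uniform opening ([uniform_cones]). Choose x with the total variation
    of sigma and, independently, a vector of the cone at x uniformly; the segment
    from the tip of that vector to x is travelled towards x when x lies in the Hahn
    set of sigma, and away from x otherwise.

    For an open set W and a part S of its boundary, let the flux be the expected
    number of times a segment leaves W through S, minus the expected number of
    times it enters W through S ([segment_flux]); let mu be the law of the starting
    point minus the law of the end point, and let m be twice a density of the
    expected time spent by the segments, once for each sense of travel. Such a
    density exists because the directions are
    spread out: the position of a segment at a fixed time before reaching x has an
    absolutely continuous law, even when sigma has atoms ([occupation_null]).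

    This is a Cauchy flux with respect to mu and m ([segment_flux_cauchy]).
    Whether a segment leaves W at a given time depends only on W near the exit
    point, which gives locality. A segment meets W in finitely or countably many
    components; each of them ends by an exit or contains the final time, and begins
    by an entrance or contains the initial time, which gives the balance law once
    the expectations are finite ([exit_flux_balance]). Finally a segment of speed
    at most 1 spends, before each exit and in the same component, a time e in the
    inner layer of width e, unless the component is too short; the short ones
    disappear as e tends to 0. So the expected number of exits through S is at most
    the limit of the layer integrals of m near S: this proves finiteness for
    admissible W ([exit_flux_lty]), and domination by every limiting measure, first
    on compact sets and then on Borel sets by inner regularity
    ([exit_flux_le_limiting]).

    For U itself, the segments leave the boundary transversally, so they spend a
    time of order e in its layer of width e and U is admissible
    ([occupation_layer]). Each segment meets the boundary of U only at its apex x,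
    which is an exit when x lies in the Hahn set and an entrance otherwise; hence
    the flux through S is sigma S ([exit_flux_cones]). *)

(** * Components of an open set of times, and their exit times *)
Section components.
Context {R : realType}.
Implicit Types (O A : set R) (q : R^nat) (s t u : R).

Definition stay O s t : Prop := forall u, s <= u <= t -> O u.

Definition linked O s t : Prop := stay O (Num.min s t) (Num.max s t).

(** A component of O is named by the least index of a sample time in it. Unlike
    a choice of end points, this is measurable in a parameter on which O
    depends, and it is the same for O and for its time reversal. *)
Definition leading O q i : Prop :=
  O (q i) /\ forall j, (j < i)%N -> ~ linked O (q j) (q i).

Definition exits O q i : Prop := leading O q i /\ ~ stay O (q i) 1.

Definition exit_time O s : R := sup [set u | s <= u <= 1 /\ stay O s u].

(** A time b is an exit of O when O contains a left neighbourhood of b but not b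
    itself. Only O near b matters, which is what makes the flux local. *)
Definition exit_set O : set R :=
  [set b | [/\ 0 < b <= 1, ~ O b & exists2 a, a < b & forall u, a < u < b -> O u]].

Definition nb_exits O A : \bar R := \esum_(b in exit_set O `&` A) 1%E.

Definition sampling q : Prop := (forall i, 0 < q i < 1) /\
  forall a b, 0 <= a -> a < b -> b <= 1 -> exists i, a < q i < b.

Lemma linkedC O s t : linked O s t <-> linked O t s.
Proof. by rewrite /linked minC maxC. Qed.

Lemma linked_le O s t : s <= t -> linked O s t <-> stay O s t.
Proof. by move=> st; rewrite /linked min_l// max_r. Qed.

Lemma linked_trans O t s u : linked O s t -> linked O t u -> linked O s u.
Proof.
move=> st tu v /andP[].
rewrite ge_min le_max => sv vu.
have [vt|tv] := leP v t; have [sv'|sv'] := leP s v.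
- by apply: st; rewrite ge_min sv'/= le_max vt orbT.
- move: sv; rewrite leNgt sv'/= => uv.
  by apply: tu; rewrite ge_min uv orbT/= le_max vt.
- move: vu => /orP[vs|vu].
    by apply: st; rewrite ge_min sv'/= le_max vs.
  by apply: tu; rewrite ge_min (ltW tv)/= le_max vu orbT.
- by apply: st; rewrite ge_min (ltW tv) orbT/= le_max (ltW sv').
Qed.

(** The sample with the least index among those linked to a given one is
    leading. *)
Lemma leading_exists O q j : O (q j) -> exists2 i, leading O q i & linked O (q i) (q j).
Proof.
move=> Oj.
have Pj : exists i, `[< linked O (q i) (q j) >].
  exists j; apply/asboolP => u; rewrite minxx maxxx => juj.
  by rewrite (_ : u = q j)//; apply/eqP; rewrite eq_le andbC.
case: (ex_minnP Pj) => i /asboolP ij imin; exists i => //; split.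
  by apply: ij; rewrite ge_min lexx/= le_max lexx.
move=> k ki kl; have /imin : `[< linked O (q k) (q j) >].
  by apply/asboolP; apply: linked_trans ij.
by rewrite leqNgt ki.
Qed.

Lemma leading_inj O q i j : leading O q i -> leading O q j ->
  linked O (q i) (q j) -> i = j.
Proof.
move=> [_ i1] [_ j1] ij; apply/eqP; rewrite eqn_leq; apply/andP; split.
  by rewrite leqNgt; apply/negP => /i1; apply; apply/linkedC.
by rewrite leqNgt; apply/negP => /j1; apply.
Qed.

(** The supremum of the times up to which O is not left is itself outside O
    because O is open, and that openness also makes it differ from s. *)
Lemma exit_time_spec O s : open O -> s <= 1 -> O s -> ~ stay O s 1 ->
  [/\ s < exit_time O s, exit_time O s <= 1, ~ O (exit_time O s) &
      forall u, s <= u < exit_time O s -> O u].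
Proof.
move=> oO s1 Os ns1; set b := exit_time O s.
have As : [set u | s <= u <= 1 /\ stay O s u] s.
  split; first by rewrite lexx.
  by move=> u; rewrite -eq_le => /eqP <-.
have hs : has_sup [set u | s <= u <= 1 /\ stay O s u].
  by split; [exists s | exists 1 => u [/andP[]]].
have sb : s <= b by apply: ub_le_sup As; case: hs.
have b1 : b <= 1 by apply: ge_sup => [|u [/andP[]]]//; exists s.
have stayb u : s <= u < b -> O u.
  move=> /andP[su ub]; have : 0 < b - u by rewrite subr_gt0.
  move=> /sup_adherent/(_ hs)[v [_ +]]; rewrite opprB -/b subrKC => sv uv.
  by apply: sv; rewrite su ltW.
have nOb : ~ O b.
  move=> Ob.
  have sOb : stay O s b.
    move=> u /andP[su]; rewrite le_eqVlt => /predU1P[->//|ub].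
    by apply: stayb; rewrite su.
  have /nbhs_ballP[e /= e0 be] : nbhs b O by exact: open_nbhs_nbhs.
  have bN1 : b != 1 by apply/eqP => b1E; apply: ns1; rewrite -b1E.
  have lb1 : b < 1 by rewrite lt_neqAle bN1.
  pose v := Num.min 1 (b + e / 2).
  have bv : b < v by rewrite lt_min lb1/= ltrDl divr_gt0.
  suff : v <= b by rewrite leNgt bv.
  apply: ub_le_sup; first by case: hs.
  split; first by rewrite (le_trans sb (ltW bv))/= ge_min lexx.
  move=> u /andP[su uv]; have [ub|bu] := leP u b; first by apply: sOb; rewrite su.
  apply: be; rewrite /ball/= distrC ger0_norm ?subr_ge0 ?(ltW bu)//.
  have : u <= b + e / 2 by rewrite (le_trans uv)// ge_min lexx orbT.
  by move: e0; lra.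
split => //; rewrite lt_neqAle sb andbT; apply/eqP => sbE.
by apply: nOb; rewrite -sbE.
Qed.

Lemma exit_time_ge0 O s : 0 <= s -> 0 <= exit_time O s.
Proof.
move=> s0; rewrite /exit_time.
have [->|/set0P[u Hu]] := eqVneq [set u | s <= u <= 1 /\ stay O s u] set0.
  by rewrite sup0.
apply: (@le_trans _ _ u); first by case: Hu => /andP[/(le_trans s0)].
by apply: ub_le_sup => //; exists 1 => v [/andP[]].
Qed.

Section sampled.
Variables (O : set R) (q : R^nat).
Hypotheses (oO : open O) (hq : sampling q).

Let q01 i : 0 < q i < 1. Proof. by case: hq. Qed.

Lemma exits_spec i : exits O q i ->
  [/\ q i < exit_time O (q i), exit_time O (q i) <= 1, ~ O (exit_time O (q i)) &
      forall u, q i <= u < exit_time O (q i) -> O u].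
Proof.
move=> [[Oi _] ns]; apply: exit_time_spec => //.
by have /andP[_ /ltW] := q01 i.
Qed.

Lemma exits_overlap i j u : exits O q i -> exits O q j ->
  q i <= u < exit_time O (q i) -> q j <= u < exit_time O (q j) -> i = j.
Proof.
move=> ei ej /andP[iu ui] /andP[ju uj].
have [_ _ _ hi] := exits_spec ei; have [_ _ _ hj] := exits_spec ej.
apply: (leading_inj ei.1 ej.1); apply: (@linked_trans _ u).
  apply/linked_le => // v /andP[iv vu]; apply: hi; rewrite iv/=.
  exact: le_lt_trans ui.
apply/linkedC/linked_le => // v /andP[jv vu]; apply: hj; rewrite jv/=.
exact: le_lt_trans uj.
Qed.

(** The right end of a component determines it, and every component contains a
    sample time. *)
Lemma exits_bij :
  set_bij [set i | exits O q i] (exit_set O) (fun i => exit_time O (q i)).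
Proof.
split.
- move=> i /= ei; have [qb b1 nOb st] := exits_spec ei.
  have /andP[q0 q1] := q01 i.
  split => //; first by rewrite b1 andbT (lt_trans q0).
  by exists (q i) => // u /andP[qu ub]; apply: st; rewrite ub ltW.
- move=> i j; rewrite !inE /= => ei ej bij.
  have [qib _ _ _] := exits_spec ei; have [qjb _ _ _] := exits_spec ej.
  have mb : Num.max (q i) (q j) < exit_time O (q i) by rewrite gt_max qib bij qjb.
  apply: (@exits_overlap _ _ (Num.max (q i) (q j))) => //.
    by rewrite le_max lexx mb.
  by rewrite le_max lexx orbT/= -bij.
- move=> b /= [/andP[b0 b1] nOb [a ab aO]].
  have [j /andP[ajq jb]] : exists j, Num.max 0 a < q j < b.
    by apply: hq.2; rewrite ?gt_max ?b0 ?ab ?le_max ?lexx.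
  have {}ajq : a < q j by apply: le_lt_trans ajq; rewrite le_max lexx orbT.
  have Oj : O (q j) by apply: aO; rewrite ajq.
  have [i li lij] := @leading_exists O q j Oj.
  have ib : q i < b.
    rewrite ltNge; apply/negP => bi; apply: nOb; apply: lij.
    by rewrite ge_min (ltW jb) orbT/= le_max bi.
  have Oib u : q i <= u < b -> O u.
    move=> /andP[iu ub]; have [uj|ju] := leP u (q j).
      by apply: lij; rewrite ge_min iu/= le_max uj orbT.
    by apply: aO; rewrite ub (lt_trans ajq).
  have ei : exits O q i.
    by split => // /(_ b); rewrite (ltW ib) b1 => /(_ isT).
  exists i => //; have [qit t1 nOt st] := exits_spec ei.
  apply/eqP; rewrite eq_le; apply/andP; split.
    rewrite leNgt; apply/negP => bt; apply: nOb; apply: st.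
    by rewrite (ltW ib) bt.
  rewrite leNgt; apply/negP => bt; apply: nOt; apply: Oib.
  by rewrite (ltW qit) bt.
Qed.

Lemma nb_exitsE A : nb_exits O A =
  \esum_(i in [set i | exits O q i /\ A (exit_time O (q i))]) 1%E.
Proof.
rewrite /nb_exits (reindex_esum [set i | exits O q i /\ A (exit_time O (q i))] _
  (fun i => exit_time O (q i)))//.
have [f1 f2 f3] := exits_bij; split.
- by move=> i /= [ei Ai]; split => //; exact: f1.
- by move=> i j; rewrite !inE /= => -[ei _] [ej _]; apply: f2; rewrite inE.
- by move=> b [/f3[i /= ei <-] Ab]; exists i.
Qed.

(** At most one component contains the final time 1. *)
Lemma esum_stay_end :
  \esum_(i in [set i | leading O q i /\ stay O (q i) 1]) 1%E
  = ((`[< O 1 >] : nat)%:R%:E : \bar R).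
Proof.
have [hO|nO1] := pselect (O 1); last first.
  rewrite asboolF// (_ : [set _ | _] = set0) ?esum_set0//.
  apply/seteqP; split=> // i [_ /(_ 1)]; have /andP[_ /ltW q1] := q01 i.
  by rewrite q1 lexx => /(_ isT).
rewrite asboolT//.
have /nbhs_ballP[e /= e0 be] : nbhs (1 : R) O by exact: open_nbhs_nbhs.
have [j /andP[jq jb]] : exists j, Num.max 0 (1 - e) < q j < 1.
  by apply: hq.2; rewrite ?gt_max ?le_max ?lexx// ltr01 gtrBl e0.
have sj : stay O (q j) 1.
  move=> u /andP[ju u1]; apply: be; rewrite /ball/= ger0_norm ?subr_ge0//.
  have : 1 - e < u.
    by apply: lt_le_trans ju; apply: le_lt_trans jq; rewrite le_max lexx orbT.
  by lra.
have Oj : O (q j) by apply: sj; rewrite lexx ltW.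
have [i li lij] := @leading_exists O q j Oj.
have lj1 : linked O (q j) 1 by apply/linked_le => //; exact: ltW.
rewrite (_ : [set _ | _] = [set i]) ?esum_set1//; apply/seteqP; split.
  move=> k /= [lk sk]; apply: (leading_inj lk li).
  apply: (@linked_trans _ 1).
    by apply/linked_le => //; have /andP[_ /ltW] := q01 k.
  by apply: (@linked_trans _ (q j)); apply/linkedC.
move=> _ ->; split => //; apply/linked_le; first by have /andP[_ /ltW] := q01 i.
exact: linked_trans lj1.
Qed.

(** Every component ends either at an exit or by containing the final time. *)
Lemma esum_leading : (\esum_(i in [set i | leading O q i]) 1
  = nb_exits O setT + (`[< O 1 >] : nat)%:R%:E :> \bar R)%E.
Proof.
rewrite nb_exitsE -esum_stay_end (esumID [set i | ~ stay O (q i) 1])//.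
congr (_ + _)%E; congr esum; apply/seteqP; split => i /=.
- by move=> [? ?].
- by move=> [[]].
- by move=> [? /contrapT].
- by move=> [? ?]; split => //; apply.
Qed.

End sampled.

(** Reversing time exchanges exits and entrances. *)
Definition reverse O : set R := [set t | O (1 - t)].

Lemma stay_reverse O s t : stay (reverse O) s t <-> stay O (1 - t) (1 - s).
Proof.
split=> st u /andP[su ut].
  by have := st (1 - u); rewrite /reverse/= subKr; apply; apply/andP; split; lra.
by apply: st; apply/andP; split; lra.
Qed.

Lemma linked_reverse O s t : linked (reverse O) (1 - s) (1 - t) <-> linked O s t.
Proof.
have aux (s' t' : R) : s' <= t' ->
    linked (reverse O) (1 - s') (1 - t') <-> linked O s' t'.
  move=> st; rewrite (linkedC (reverse O)) (linked_le O st).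
  have st' : 1 - t' <= 1 - s' by rewrite lerB.
  by rewrite (linked_le _ st') stay_reverse !subKr.
have [st|/ltW ts] := leP s t; first exact: aux.
by rewrite linkedC (linkedC O); exact: aux.
Qed.

Lemma leading_reverse O q i :
  leading (reverse O) (fun j => 1 - q j) i <-> leading O q i.
Proof.
rewrite /leading /reverse/= subKr; split=> -[Oi H]; split=> // j /H jl lk.
  by apply: jl; apply/linked_reverse.
by apply: jl; move/linked_reverse : lk.
Qed.

Lemma sampling_reverse q : sampling q -> sampling (fun j => 1 - q j).
Proof.
move=> [q01 dq]; split=> [i|a b a0 ab b1].
  by have /andP[? ?] := q01 i; apply/andP; split; lra.
have [|||i /andP[? ?]] := dq (1 - b) (1 - a); [lra|lra|lra|].
by exists i; apply/andP; split; lra.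
Qed.

Lemma open_reverse O : open O -> open (reverse O).
Proof.
move=> oO; apply: open_comp => // t _.
by apply: continuousB; [exact: cst_continuous|exact: cvg_id].
Qed.

(** Both sides count the components of O: going forward a component ends at an
    exit or at time 1, going backward it ends at an entrance or at time 0. This
    identity of possibly infinite numbers becomes the balance law. *)
Lemma nb_exits_balance O q : open O -> sampling q ->
  (nb_exits O setT + (`[< O 1 >] : nat)%:R%:E =
   nb_exits (reverse O) setT + (`[< O 0 >] : nat)%:R%:E)%E.
Proof.
move=> oO hq; rewrite -(esum_leading oO hq).
rewrite (_ : `[< O 0 >] = `[< reverse O 1 >]); last by rewrite /reverse/= subrr.
rewrite -(esum_leading (open_reverse oO) (sampling_reverse hq)); congr esum.
by apply/seteqP; split => i /leading_reverse.
Qed.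

Lemma sampling_exists : exists q : R^nat, sampling q.
Proof.
have [f] : exists f : nat -> rat, range f = setT.
  exists (fun n => odflt 0 (unpickle n)).
  by apply/seteqP; split => // r _; exists (pickle r) => //=; rewrite pickleK.
pose q n : R := if 0 < (ratr (f n) : R) < 1 then ratr (f n) else 2^-1.
move=> fT; exists q; split.
  by move=> i; rewrite /q; case: ifPn => // _; apply/andP; split; lra.
move=> a b a0 ab b1; have [r] : exists r : rat, ratr r \in `]a, b[ by apply: rat_in_itvoo.
rewrite in_itv/= => /andP[ar rb].
have [n _ fn] : range f r by rewrite fT.
exists n; rewrite /q fn (le_lt_trans a0 ar) (lt_le_trans rb b1)/=.
by rewrite ar rb.
Qed.

End components.

(** * Euclidean norm, tubes and measurability on row vectors *)
Section euclidean_rV.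
Context {R : realType} {n : nat}.
Local Notation V := 'rV[R]_n.
Implicit Types (x y : V) (A K W : set V).

Lemma eucl_norm_ge0 x : 0 <= eucl_norm x.
Proof. exact: sqrtr_ge0. Qed.

Lemma eucl_normZ (c : R) x : eucl_norm (c *: x) = `|c| * eucl_norm x.
Proof.
rewrite /eucl_norm; under eq_bigr do rewrite mxE exprMn.
by rewrite -mulr_sumr sqrtrM ?sqr_ge0// sqrtr_sqr.
Qed.

Lemma eucl_normN x : eucl_norm (- x) = eucl_norm x.
Proof. by rewrite -scaleN1r eucl_normZ normrN1 mul1r. Qed.

Lemma coord_le_eucl_norm x i : `|x ord0 i| <= eucl_norm x.
Proof.
rewrite -sqrtr_sqr ler_wsqrtr// (bigD1 i)//= lerDl.
by apply: sumr_ge0 => j _; exact: sqr_ge0.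
Qed.

Lemma coord_le_mx_norm x i : `|x ord0 i| <= `|x|.
Proof.
rewrite [leRHS]/Num.Def.normr/= mx_normrE; apply/bigmax_geP; right => /=.
by exists (ord0, i).
Qed.

Lemma mx_norm_le x (c : R) : 0 <= c -> (forall i, `|x ord0 i| <= c) -> `|x| <= c.
Proof.
move=> c0 xc; rewrite [leLHS]/Num.Def.normr/= mx_normrE; apply: bigmax_le => // -[i j] _.
by rewrite (ord1 i) xc.
Qed.

Lemma mx_norm_le_eucl x : `|x| <= eucl_norm x.
Proof.
by apply: mx_norm_le => [|i]; [exact: eucl_norm_ge0|exact: coord_le_eucl_norm].
Qed.

Lemma eucl_norm_le_mx x : eucl_norm x <= n%:R * `|x|.
Proof.
rewrite -[leRHS]ger0_norm ?mulr_ge0// -[leRHS]sqrtr_sqr ler_wsqrtr// exprMn.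
apply: (@le_trans _ _ (\sum_(i < n) `|x| ^+ 2)).
  apply: ler_sum => i _; rewrite -real_normK ?num_real//.
  by rewrite ler_sqr ?nnegrE// coord_le_mx_norm.
rewrite sumr_const card_ord -[leLHS]mulr_natl ler_wpM2r ?sqr_ge0//.
by rewrite -natrX ler_nat; case: (n) => // k; rewrite expnS expn1 leq_pmulr.
Qed.

Lemma eucl_norm_continuous : continuous (@eucl_norm R n).
Proof.
have sum_cont : continuous (fun y : V => \sum_i y ord0 i ^+ 2).
  apply: continuous_big => [|i _]; first exact: add_continuous.
  move=> y; apply: (@continuous_comp _ _ _ (fun y : V => y ord0 i) (fun t : R => t ^+ 2)).
    exact: coord_continuous.
  exact: exprn_continuous.
move=> x; apply: (@continuous_comp _ _ _ _ Num.sqrt); first exact: sum_cont.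
exact: sqrt_continuous.
Qed.

Lemma open_eucl_ball x (e : R) : open [set y | eucl_norm (y - x) < e].
Proof.
rewrite (_ : [set y | _] = (fun y => eucl_norm (y - x)) @^-1` [set t | t < e])//.
apply: open_comp; last exact: open_lt.
move=> y _; apply: (@continuous_comp _ _ _ (fun y => y - x) (@eucl_norm R n)).
  by apply: continuousB; [exact: cvg_id|exact: cst_continuous].
exact: eucl_norm_continuous.
Qed.

Lemma tubeP (e : R) A x :
  tube e A x <-> exists2 y, A y & eucl_norm (x - y) < e.
Proof.
split.
  by move=> /ereal_inf_lt[_ [y Ay <-]]; rewrite lte_fin => xy; exists y.
move=> [y Ay xy]; rewrite /tube/= /eucl_dist; apply: (@le_lt_trans _ _ (eucl_norm (x - y))%:E).
  by apply: ereal_inf_lbound; exists y.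
by rewrite lte_fin.
Qed.

Lemma open_tube (e : R) A : open (tube e A).
Proof.
rewrite (_ : tube e A = \bigcup_(y in A) [set x | eucl_norm (x - y) < e]).
  by apply: bigcup_open => y _; exact: open_eucl_ball.
apply/seteqP; split => x; first by move=> /tubeP[y Ay xy]; exists y.
by move=> [y Ay xy]; apply/tubeP; exists y.
Qed.

Lemma closed_measurable_mx A : closed A -> measurable A.
Proof.
move=> cA; rewrite -(setCK A); apply: measurableC; apply: open_measurable_mx.
exact: closed_openC.
Qed.

Lemma boundary_nmem W x : open W -> boundary W x -> ~ W x.
Proof. by move=> oW [_]; rewrite (interior_id _).1. Qed.

Lemma boundary_measurable W : measurable (boundary W).
Proof.
apply: measurableD; first by apply: closed_measurable_mx; exact: closed_closure.
apply: open_measurable_mx; exact: open_interior.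
Qed.


(** The points at distance at least r from the complement of W: these closed
    sets exhaust an open W. *)
Definition core W (r : R) : set V := [set x | ball x r `<=` W].

Lemma closed_core W r : closed (core W r).
Proof.
rewrite (_ : core W r = \bigcap_(y in ~` W) ~` ball y r).
  apply: closed_bigI => y _; apply: open_closedC; exact: ball_open.
apply/seteqP; split=> x /=.
  by move=> xW y nWy yx; apply: nWy; apply: xW; exact: ball_sym.
by move=> H y xy; apply: contrapT => /H; apply; exact: ball_sym.
Qed.

Lemma compact_sub_core K W : compact K -> K `<=` W -> open W ->
  \forall r \near 0^'+, K `<=` core W r.
Proof.
move/compact_near_coveringP => cK KW oW.
apply: (cK _ (0^'+ : set_system R) (fun r x => core W r x) _) => x /KW Wx.
have /nbhs_ballP[e /= e0 be] : nbhs x W by exact: open_nbhs_nbhs.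
have e2 : 0 < e / 2 by rewrite divr_gt0.
exists (ball x (e / 2), [set r | r < e / 2]) => /=.
  by split; [exact: nbhsx_ballx|exact: nbhs_right_lt].
move=> [y r] /= [xy re] z yz; apply: be; rewrite (splitr e).
by apply: ball_triangle xy _; apply: le_ball yz; exact: ltW.
Qed.

(** Open sets are countable unions of rational boxes. *)
Lemma measurable_fun_rV d (T : measurableType d) (f : T -> V) :
  (forall i, measurable_fun setT (fun t => f t ord0 i)) -> measurable_fun setT f.
Proof.
move=> mf; apply: (@measurability _ _ _ _ _ _ (@open V)) => //.
move=> _ [W oW <-]; rewrite setTI (open_rV_bigcup_ball oW) preimage_bigcup.
apply: countable_bigcupT_measurable; first exact: countableP.
move=> [p r]; case: ifPn => _; last by rewrite preimage_set0.
have [r0|r0] := ltP 0 (ratr r : R); last first.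
  rewrite (_ : _ @^-1` _ = set0)//; apply/seteqP; split=> // t [/= r1].
  by move: r0; rewrite leNgt r1.
rewrite (_ : _ @^-1` _ = \bigcap_(i : 'I_n)
   ((fun t => f t ord0 i) @^-1` ball (ratr (p ord0 i) : R) (ratr r))).
  apply: fin_bigcap_measurable => // i _; rewrite -[X in measurable X]setTI.
  by apply: mf => //; apply: open_measurable; exact: ball_open.
apply/seteqP; split=> [t [/= _ ft] i _|t ft].
  by have := ft ord0 i; rewrite mxE.
by split => // i j; rewrite mxE (ord1 i); exact: ft.
Qed.

Lemma measurable_coord i : measurable_fun setT (fun x : V => x ord0 i).
Proof.
have mi : measurable_fun setT (fun x : V => x ord0 i : measurableTypeR R).
  apply: (measurability _ (RGenOpens.measurableE R)) => _ [_ [a [b ->]] <-].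
  rewrite setTI; apply: open_measurable_mx; apply: open_comp => //.
  by move=> x _; exact: coord_continuous.
exact: mi.
Qed.

Lemma measurable_fun_coord d (T : measurableType d) (f : T -> V) i :
  measurable_fun setT f -> measurable_fun setT (fun t => f t ord0 i).
Proof. by move=> mf; apply: (measurableT_comp (measurable_coord i)). Qed.

End euclidean_rV.

(** * Random segments *)
Section segments.
Context {R : realType} {n : nat} {d} {Theta : measurableType d}.
Local Notation V := 'rV[R]_n.
Implicit Types (y : Theta -> V) (W S : set V) (q : R^nat).

Definition segm y0 y1 (th : Theta) (t : R) : V := y0 th + t *: (y1 th - y0 th).

Definition trace y0 y1 W (th : Theta) : set R := segm y0 y1 th @^-1` W.

Definition exit_point y0 y1 W q i (th : Theta) : V :=
  segm y0 y1 th (exit_time (trace y0 y1 W th) (q i)).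

Definition exit_event y0 y1 W q i : set Theta :=
  [set th | exits (trace y0 y1 W th) q i].

Lemma segm_continuous y0 y1 th : continuous (segm y0 y1 th).
Proof.
move=> t; apply: cvgD; first exact: cvg_cst.
by apply: cvgZr_tmp; exact: cvg_id.
Qed.

Lemma open_trace y0 y1 W th : open W -> open (trace y0 y1 W th).
Proof. by move=> oW; apply: open_comp => // t _; exact: segm_continuous. Qed.

Lemma segm0 y0 y1 th : segm y0 y1 th 0 = y0 th.
Proof. by rewrite /segm scale0r addr0. Qed.

Lemma segm1 y0 y1 th : segm y0 y1 th 1 = y1 th.
Proof. by rewrite /segm scale1r addrC subrK. Qed.

Lemma segm_reverse y0 y1 th t : segm y1 y0 th t = segm y0 y1 th (1 - t).
Proof.
by apply/rowP => i; rewrite !mxE; ring.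
Qed.

Lemma trace_reverse y0 y1 W th : trace y1 y0 W th = reverse (trace y0 y1 W th).
Proof. by apply/funext => t; rewrite /trace /reverse/= segm_reverse. Qed.

Lemma segmB y0 y1 th s t :
  segm y0 y1 th s - segm y0 y1 th t = (s - t) *: (y1 th - y0 th).
Proof. by rewrite /segm opprD addrACA subrr add0r -scalerBl. Qed.

Section measurability.
Variables (y0 y1 : Theta -> V).
Hypotheses (my0 : measurable_fun setT y0) (my1 : measurable_fun setT y1).
Local Notation pth := (segm y0 y1).

Lemma measurable_fun_segm d' (T : measurableType d') (f : T -> Theta) (g : T -> R) :
  measurable_fun setT f -> measurable_fun setT g ->
  measurable_fun setT (fun t => pth (f t) (g t)).
Proof.
move=> mf mg; apply: measurable_fun_rV => i.
rewrite (_ : (fun t => _) = (fun t => y0 (f t) ord0 i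
    + g t * (y1 (f t) ord0 i - y0 (f t) ord0 i))); last first.
  by apply/funext => t; rewrite !mxE.
have m0 : measurable_fun setT (fun t => y0 (f t) ord0 i).
  by apply: measurable_fun_coord; exact: measurableT_comp.
have m1 : measurable_fun setT (fun t => y1 (f t) ord0 i).
  by apply: measurable_fun_coord; exact: measurableT_comp.
by apply: measurable_funD => //; apply: measurable_funM => //; exact: measurable_funB.
Qed.

Section in_open.
Variables (W : set V) (q : R^nat).
Hypotheses (oW : open W) (hq : sampling q).
Local Notation tr := (trace y0 y1 W).

Let measurable_preim (A : set V) (f : Theta -> R) : measurable_fun setT f ->
  measurable A -> measurable [set th | A (pth th (f th))].
Proof.
move=> mf mA; rewrite -[X in measurable X]setTI.
by apply: (@measurable_fun_segm _ _ id f).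
Qed.

Lemma measurable_trace t : measurable [set th | tr th t].
Proof. by apply: (@measurable_preim W (cst t)) => //; exact: open_measurable_mx. Qed.

(** A segment stays in the open set W on a compact time interval iff its
    positions at countably many dense times stay at a common positive distance
    from the complement of W. *)
Lemma measurable_stay s t : s <= t -> measurable [set th | stay (tr th) s t].
Proof.
move=> st; rewrite (_ : [set th | _] = \bigcup_k \bigcap_j
    [set th | core W (k.+1%:R^-1) (pth th (s + (t - s) * q j))]).
  apply: bigcup_measurable => k _; apply: bigcap_measurable => // j _.
  apply: (@measurable_preim _ (cst _)) => //.
  by apply: closed_measurable_mx; exact: closed_core.
apply/seteqP; split=> th /=.
  move=> sth; have cK : compact (pth th @` `[s, t]).
    apply: continuous_compact; last exact: segment_compact.
    by apply: continuous_subspaceT; exact: segm_continuous.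
  have KW : pth th @` `[s, t] `<=` W.
    by move=> _ [u /= + <-]; rewrite in_itv/= => /sth.
  have [e /= e0 He] := compact_sub_core cK KW oW.
  have [k ke] : exists k, k.+1%:R^-1 < e :> R.
    have [k _ /(_ k (leqnn k)) ke] := near_infty_natSinv_lt (PosNum e0).
    by exists k.
  exists k => // j _; apply: (He k.+1%:R^-1).
  - by rewrite /ball_/= sub0r normrN gtr0_norm.
  - by rewrite /= invr_gt0.
  exists (s + (t - s) * q j) => //=; rewrite in_itv/=.
  have /andP[q0 q1] := hq.1 j; rewrite lerDl mulr_ge0 ?subr_ge0// ?(ltW q0)//=.
  by rewrite -lerBrDl ler_piMr ?subr_ge0// ltW.
move=> [k _ H] u /andP[su ut].
have k0 : 0 < k.+1%:R^-1 :> R by rewrite invr_gt0.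
have /(_ u)/nbhs_ballP[e /= e0 be] : forall u, nbhs u (pth th @^-1` ball (pth th u) (k.+1%:R^-1)).
  by move=> v; apply: segm_continuous; exact: nbhsx_ballx.
have [j uj] : exists j, ball u e (s + (t - s) * q j).
  move: st; rewrite le_eqVlt => /predU1P[ts|st].
    exists 0%N; have -> : u = s by apply/eqP; rewrite eq_le su ts ut.
    by rewrite ts subrr mul0r addr0; exact: ballxx.
  have ts0 : 0 < t - s by rewrite subr_gt0.
  pose a := Num.max 0 ((u - e / 2 - s) / (t - s)).
  pose b := Num.min 1 ((u + e / 2 - s) / (t - s)).
  have [|||j /andP[]] := hq.2 a b.
  - by rewrite le_max lexx.
  - rewrite gt_max !lt_min ltr01/= divr_gt0//=; last by lra.
    rewrite ltr_pdivrMr// mul1r ltr_pM2r ?invr_gt0//.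
    by apply/andP; split; lra.
  - by rewrite ge_min lexx.
  rewrite gt_max lt_min => /andP[_ aj] /andP[_ jb]; exists j.
  move: aj jb; rewrite ltr_pdivrMr// ltr_pdivlMr// [q j * _]mulrC => aj jb.
  by rewrite /ball/= ltr_distlC; apply/andP; split; lra.
by apply: (H j) => //; apply: ball_sym; exact: be.
Qed.

Lemma measurable_leading i : measurable [set th | leading (tr th) q i].
Proof.
rewrite (_ : [set th | _] = [set th | tr th (q i)] `&`
   \bigcap_(j in `I_i) ~` [set th | linked (tr th) (q j) (q i)]).
  apply: measurableI; first exact: measurable_trace.
  apply: fin_bigcap_measurable; first exact: finite_II.
  move=> j _; apply: measurableC; apply: measurable_stay.
  by rewrite ge_min le_max lexx.
by [].
Qed.

Lemma measurable_exit_event i : measurable (exit_event y0 y1 W q i).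
Proof.
rewrite (_ : exit_event _ _ _ _ _ = [set th | leading (tr th) q i] `\`
   [set th | stay (tr th) (q i) 1]).
  apply: measurableD; first exact: measurable_leading.
  by apply: measurable_stay; have /andP[_ /ltW] := hq.1 i.
by [].
Qed.

(** The exit time exceeds r iff, for some sample time beyond r, the segment has
    not left W before it. *)
Lemma measurable_exit_time i : measurable_fun setT (fun th => exit_time (tr th) (q i)).
Proof.
apply: (measurability _ (RGenOInfty.measurableE R)) => _ [_ [r ->] <-].
rewrite setTI.
have [r0|r0] := ltP r 0.
  rewrite (_ : _ @^-1` _ = setT)//; apply/seteqP; split => // th _ /=.
  rewrite in_itv/= andbT (lt_le_trans r0)//.
  have /andP[q0 _] := hq.1 i; exact/exit_time_ge0/ltW.
rewrite (_ : _ @^-1` _ = \bigcup_(j in [set j | q i <= q j /\ r < q j])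
   [set th | stay (tr th) (q i) (q j)]).
  by apply: bigcup_measurable => j [ij _]; exact: measurable_stay.
apply/seteqP; split=> th /=.
  rewrite in_itv/= andbT => rb.
  have [E|ne] := eqVneq [set u | q i <= u <= 1 /\ stay (tr th) (q i) u] set0.
    by move: rb; rewrite /exit_time E sup0 ltNge r0.
  have hs : has_sup [set u | q i <= u <= 1 /\ stay (tr th) (q i) u].
    by split; [exact/set0P|exists 1 => u [/andP[]]].
  have [u [/andP[iu u1] su] ru] : exists2 u,
      q i <= u <= 1 /\ stay (tr th) (q i) u & r < u.
    have : 0 < exit_time (tr th) (q i) - r by rewrite subr_gt0.
    by move=> /sup_adherent/(_ hs)[u Hu]; rewrite subKr => ?; exists u.
  have [ui|qiu] := eqVneq u (q i); first by exists i; rewrite -?ui//= ui in su ru *.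
  have [|||j /andP[]] := hq.2 (Num.max r (q i)) u.
  - by rewrite le_max r0.
  - by rewrite gt_max ru lt_neqAle eq_sym qiu.
  - exact: u1.
  rewrite gt_max =>  /andP[rj ij] ju; exists j; first by rewrite /= (ltW ij).
  by move=> v /andP[iv vj]; apply: su; rewrite iv (le_trans vj (ltW ju)).
move=> [j [ij rj] sj]; rewrite in_itv/= andbT (lt_le_trans rj)//.
apply: ub_le_sup; first by exists 1 => u [/andP[]].
by split => //; rewrite ij; have /andP[_ /ltW] := hq.1 j.
Qed.

Lemma measurable_exit_point i : measurable_fun setT (exit_point y0 y1 W q i).
Proof. by apply: (@measurable_fun_segm _ _ id) => //; exact: measurable_exit_time. Qed.

End in_open.
End measurability.
End segments.

(** * The measure counting exits of random segments *)
Section exit_flux.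
Context {R : realType} {n : nat} {d} {Theta : measurableType d}.
Local Notation V := 'rV[R]_n.
Variable P : {finite_measure set Theta -> \bar R}.
Variables (y0 y1 : Theta -> V).
Hypotheses (my0 : measurable_fun setT y0) (my1 : measurable_fun setT y1).
Variables (W : set V) (q : R^nat).
Hypotheses (oW : open W) (hq : sampling q).
Local Notation tr := (trace y0 y1 W).
Local Notation pth := (segm y0 y1).
Local Open Scope ereal_scope.

(** The law of the exit point of the component with index i, restricted to the
    event that this component exists and has an exit. *)
Definition exit_piece i : {measure set V -> \bar R} :=
  measure_function_pushforward__canonical__measure_function_Measure
    (mrestr P (measurable_exit_event my0 my1 oW hq i))
    (measurable_exit_point my0 my1 oW hq i).

Definition exit_flux : set V -> \bar R := mseries exit_piece 0.

HB.instance Definition _ := Measure.on exit_flux.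

Definition exits_at i S : set Theta := exit_event y0 y1 W q i `&` exit_point y0 y1 W q i @^-1` S.

Lemma measurable_exits_at i S : measurable S -> measurable (exits_at i S).
Proof.
move=> mS; apply: measurableI; first exact: measurable_exit_event.
by rewrite -[X in measurable X]setTI; apply: measurable_exit_point.
Qed.

Lemma exit_fluxE S : exit_flux S = \sum_(i <oo) P (exits_at i S).
Proof. by apply: eq_eseriesr => i _; rewrite /exits_at setIC. Qed.

Lemma nb_exits_series th S :
  nb_exits (tr th) (pth th @^-1` S) = \sum_(i <oo) (\1_(exits_at i S) th)%:E.
Proof.
rewrite (nb_exitsE (open_trace oW) hq) nneseries_esumT//.
rewrite esum_mkcond; apply: eq_esum => i _; rewrite indicE.
rewrite (_ : (i \in _) = (th \in exits_at i S)); first by case: ifPn.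
by apply/idP/idP; rewrite !inE.
Qed.

Lemma measurable_nb_exits S : measurable S ->
  measurable_fun setT (fun th => nb_exits (tr th) (pth th @^-1` S)).
Proof.
move=> mS; under eq_fun do rewrite nb_exits_series.
apply: (@ge0_emeasurable_sum _ _ _ _ (fun i th => (\1_(exits_at i S) th)%:E) xpredT).
  by move=> i th _ _; rewrite lee_fin.
move=> i _; apply/measurable_EFinP/measurable_indic; exact: measurable_exits_at.
Qed.

(** The measure of S is the expected number of exits through S. The number of
    exits does not refer to the enumeration of components, so this form is the
    one used for locality and balance. *)
Lemma exit_flux_integral S : measurable S ->
  exit_flux S = \int[P]_th nb_exits (tr th) (pth th @^-1` S).
Proof.
move=> mS; under eq_integral do rewrite nb_exits_series.
rewrite integral_nneseries//; last first.
  by move=> i; apply/measurable_EFinP/measurable_indic; exact: measurable_exits_at.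
rewrite exit_fluxE; apply: eq_eseriesr => i _.
by rewrite integral_indic ?setIT//; exact: measurable_exits_at.
Qed.

Lemma exit_point_boundary th b : exit_set (tr th) b -> boundary W (pth th b).
Proof.
move=> [/andP[b0 b1] nWb [a ab aW]]; split; last by move=> /interior_subset.
move=> B /= /segm_continuous /nbhs_ballP[e /= e0 be].
pose u := (b - Num.min e (b - a) / 2)%R.
have m0 : (0 < Num.min e (b - a))%R by rewrite lt_min e0 subr_gt0.
have me : (Num.min e (b - a) <= e)%R by rewrite ge_min lexx.
have mba : (Num.min e (b - a) <= b - a)%R by rewrite ge_min lexx orbT.
exists (pth th u); split.
  by apply: aW; rewrite /u; apply/andP; split; lra.
by apply: be; rewrite /ball/= /u; rewrite ltr_distlC; apply/andP; split; lra.
Qed.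

Lemma exit_flux_boundary : exit_flux (boundary W) = exit_flux setT.
Proof.
rewrite !exit_flux_integral//; last exact: boundary_measurable.
apply: eq_integral => th _; congr esum; apply/seteqP; split => b [eb _] //.
by split => //; exact: exit_point_boundary.
Qed.

End exit_flux.

Section flux_identities.
Context {R : realType} {n : nat} {d} {Theta : measurableType d}.
Local Notation V := 'rV[R]_n.
Variable P : {finite_measure set Theta -> \bar R}.
Variables (y0 y1 : Theta -> V).
Hypotheses (my0 : measurable_fun setT y0) (my1 : measurable_fun setT y1).
Variable (q : R^nat).
Hypothesis hq : sampling q.

Let exit_set_local (W1 W2 A : set V) th b : open A -> A `&` W1 = A `&` W2 ->
  A (segm y0 y1 th b) -> exit_set (trace y0 y1 W1 th) b ->
  exit_set (trace y0 y1 W2 th) b.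
Proof.
move=> oA AW Ab [b01 nW [a ab aW]]; split => //.
  by move=> W2b; apply: nW; have [] : (A `&` W1) (segm y0 y1 th b) by rewrite AW.
have nA : nbhs (segm y0 y1 th b) A by exact: open_nbhs_nbhs.
have /nbhs_ballP[e /= e0 be] := segm_continuous nA.
exists (Num.max a (b - e)); first by rewrite gt_max ab gtrBl.
move=> u /andP[]; rewrite gt_max => /andP[au ebu] ub.
suff : (A `&` W2) (segm y0 y1 th u) by move=> [].
rewrite -AW; split; last by apply: aW; rewrite au.
by apply: be; rewrite /ball/= ltr_distlC; apply/andP; split; lra.
Qed.

(** Inside A the exits only depend on the part of the open set in A. *)
Lemma exit_flux_local (W1 W2 A : set V) (oW1 : open W1) (oW2 : open W2) :
  open A -> A `&` W1 = A `&` W2 ->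
  exit_flux P my0 my1 oW1 hq (A `&` boundary W1) =
  exit_flux P my0 my1 oW2 hq (A `&` boundary W2).
Proof.
move=> oA AW; rewrite !exit_flux_integral//; last 2 first.
- by apply: measurableI; [exact: open_measurable_mx|exact: boundary_measurable].
- by apply: measurableI; [exact: open_measurable_mx|exact: boundary_measurable].
apply: eq_integral => th _; congr esum; apply/seteqP; split => b /= [eb [Ab _]].
  have eb2 := exit_set_local oA AW Ab eb.
  by split => //; split => //; exact: exit_point_boundary eb2.
have eb2 := exit_set_local oA (esym AW) Ab eb.
by split => //; split => //; exact: exit_point_boundary eb2.
Qed.

Local Open Scope ereal_scope.

(** The pathwise identity between exits and entrances, integrated. Reversing the
    segments turns exits into entrances. *)
Lemma exit_flux_balance (W : set V) (oW : open W) :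
  exit_flux P my0 my1 oW hq setT + P (y1 @^-1` W) =
  exit_flux P my1 my0 oW hq setT + P (y0 @^-1` W).
Proof.
have mW : measurable W by exact: open_measurable_mx.
have mpre (y : Theta -> V) : measurable_fun setT y -> measurable (y @^-1` W).
  by move=> my; rewrite -[X in measurable X]setTI; exact: my.
have PE (y : Theta -> V) : measurable_fun setT y ->
    P (y @^-1` W) = \int[P]_th (\1_(y @^-1` W) th)%:E.
  by move=> my; rewrite integral_indic ?setIT//; exact: mpre.
have mE (y : Theta -> V) : measurable_fun setT y ->
    measurable_fun setT (fun th => (\1_(y @^-1` W) th)%:E : \bar R).
  by move=> my; apply/measurable_EFinP/measurable_indic; exact: mpre.
have nb0 S S' : 0 <= nb_exits S S' :> \bar R by apply: esum_ge0.
rewrite !exit_flux_integral// !PE// -!ge0_integralD//.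
- apply: eq_integral => th _; rewrite !preimage_setT.
  rewrite (trace_reverse y0 y1) !indicE.
  have := nb_exits_balance (open_trace (y0 := y0) (y1 := y1) (th := th) oW) hq.
  rewrite /trace /= segm0 segm1.
  by congr (_ + (nat_of_bool _)%:R%:E = _ + (nat_of_bool _)%:R%:E);
     apply/idP/idP; rewrite !inE => /asboolP.
all: rewrite ?lee_fin//.
- exact: (measurable_nb_exits my1 my0 oW hq measurableT).
- exact: mE.
- exact: (measurable_nb_exits my0 my1 oW hq measurableT).
- exact: mE.
Qed.

End flux_identities.

(** * Exits and the mass of inner layers *)
Section unit_time.
Local Open Scope ereal_scope.
Context {R : realType}.

Let unit_lty : lebesgue_measure (`[0%R, 1%R]%classic : set (measurableTypeR R)) < +oo.
Proof. by rewrite lebesgue_measure_itv/= lte_fin ltr01 oppr0 adde0 ltry. Qed.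

Definition unit_time : {finite_measure set (measurableTypeR R) -> \bar R} :=
  @mfrestr _ (measurableTypeR R) R _ lebesgue_measure
    (measurable_itv `[0%R, 1%R]) unit_lty.

Lemma unit_timeE A : unit_time A = lebesgue_measure (A `&` `[0%R, 1%R]).
Proof. by []. Qed.

End unit_time.

Section layers.
Local Open Scope ereal_scope.
Context {R : realType} {n : nat} {d} {Theta : measurableType d}.
Local Notation V := 'rV[R]_n.
Variable P : {finite_measure set Theta -> \bar R}.
Variables (y0 y1 : Theta -> V).

(** The expected time that a segment spends in B. *)
Definition occupation (B : set V) : \bar R :=
  (P \x unit_time) ((fun z => segm y0 y1 z.1 z.2) @^-1` B).

Hypotheses (my0 : measurable_fun setT y0) (my1 : measurable_fun setT y1).

Lemma measurable_segm2 : measurable_fun setT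
  (fun z : Theta * measurableTypeR R => segm y0 y1 z.1 z.2).
Proof. exact: (measurable_fun_segm my0 my1 measurable_fst measurable_snd). Qed.

Variables (W : set V) (q : R^nat).
Hypotheses (oW : open W) (hq : sampling q).
Hypothesis speed1 : forall th, (eucl_norm (y1 th - y0 th) <= 1)%R.
Local Notation tr := (trace y0 y1 W).
Local Notation b_ i th := (exit_time (tr th) (q i)).

(** The duration is measured from the leading sample of the component and not
    from its beginning; every exit becomes long as e decreases to 0. *)
Definition long_exits i S (e : R) : set Theta :=
  exits_at y0 y1 W q i S `&` [set th | e < b_ i th - q i]%R.

Let measurable_exit_time' i := measurable_exit_time my0 my1 oW hq i.

Lemma measurable_long_exits i S e : measurable S -> measurable (long_exits i S e).
Proof.
move=> mS; apply: measurableI; first exact: (measurable_exits_at my0 my1 oW hq).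
rewrite (_ : [set th | _] = (fun th => b_ i th - q i)%R @^-1` `]e, +oo[%classic).
  rewrite -[X in measurable X]setTI.
  by apply: measurable_funB => //; exact: measurable_exit_time'.
by apply/seteqP; split => th /=; rewrite in_itv/= andbT.
Qed.

Let before_exit i S (e : R) : set (Theta * measurableTypeR R) :=
  [set z | long_exits i S e z.1 /\ (b_ i z.1 - z.2)%R \in `]0%R, e[ ].

Let measurable_before_exit i S e : measurable S -> measurable (before_exit i S e).
Proof.
move=> mS; rewrite (_ : before_exit i S e = (fst @^-1` long_exits i S e) `&`
    (fun z : Theta * measurableTypeR R => b_ i z.1 - z.2)%R @^-1` `]0%R, e[%classic)//.
apply: measurableI.
  rewrite -[X in measurable X]setTI.
  have mF := @measurable_fst _ _ Theta (measurableTypeR R).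
  exact: (mF measurableT _ (measurable_long_exits i e mS)).
have m1 : measurable_fun setT (fun z : Theta * measurableTypeR R => b_ i z.1).
  exact: (measurableT_comp (measurable_exit_time' i) measurable_fst).
have m2 : measurable_fun setT (fun z : Theta * measurableTypeR R => z.2 : R).
  exact: measurable_snd.
have m12 := measurable_funB m1 m2.
rewrite -[X in measurable X]setTI.
exact: (m12 measurableT _ (measurable_itv `]0%R, e[)).
Qed.

Let before_exitE i S (e : R) : (0 < e)%R -> measurable S ->
  (P \x unit_time) (before_exit i S e) = e%:E * P (long_exits i S e).
Proof.
move=> e0 mS; rewrite /product_measure1.
under eq_integral => th _.
  rewrite /comp (_ : unit_time _ = e%:E * (\1_(long_exits i S e) th)%:E); first over.
  rewrite unit_timeE indicE; have [|nF] := boolP (th \in long_exits i S e).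
    rewrite inE => Fth; rewrite mule1.
    rewrite (_ : _ `&` _ = `](b_ i th - e)%R, b_ i th[%classic).
      by rewrite lebesgue_measure_itv/= lte_fin gtrBl e0 -EFinD opprB addrC subrK.
    have /andP[q0 _] := hq.1 i.
    have [_ b1 _ _] := exits_spec (open_trace oW) hq Fth.1.1.
    have eb := Fth.2; rewrite /= in eb.
    apply/seteqP; split => t /=.
      rewrite /xsection/= inE /before_exit /= => -[[_ +] _]; rewrite !in_itv/=.
      by move=> /andP[? ?]; apply/andP; split; lra.
    rewrite in_itv/= => /andP[t1 t2]; split.
      by rewrite /xsection/= inE; split => //=; rewrite in_itv/=; apply/andP; split; lra.
    by rewrite in_itv/=; apply/andP; split; lra.
  rewrite mule0 (_ : _ `&` _ = set0) ?measure0//.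
  apply/seteqP; split => // t [+ _]; rewrite /xsection/= inE => -[Fth _].
  by move: nF; rewrite notin_setE; exact.
rewrite ge0_integralZl ?lee_fin ?ltW//; last first.
  by apply/measurable_EFinP/measurable_indic; exact: measurable_long_exits.
by rewrite integral_indic ?setIT//; exact: measurable_long_exits.
Qed.

(** During the time e before a long exit the segment runs in W at distance less
    than e from its exit point, as its speed is at most 1. The time intervals
    preceding different exits are disjoint, because they lie in different
    components. *)
Lemma long_exits_le_occupation S (B : set V) (e : R) : (0 < e)%R ->
  measurable S -> measurable B ->
  (forall x s, W x -> S s -> boundary W s -> (eucl_norm (x - s) < e)%R -> B x) ->
  e%:E * \sum_(i <oo) P (long_exits i S e) <= occupation B.
Proof.
move=> e0 mS mB SB; rewrite -nneseriesZl//.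
under eq_eseriesr do rewrite -before_exitE//.
have mbe i := measurable_before_exit i e mS.
have mseg : measurable ((fun z => segm y0 y1 z.1 z.2) @^-1` B).
  by rewrite -[X in measurable X]setTI; exact: measurable_segm2.
rewrite (_ : \sum_(i <oo) _ = (P \x unit_time) (\bigcup_i before_exit i S e)).
  apply: le_measure; rewrite ?inE//; first exact: bigcup_measurable.
  move=> [th t] [i _ [/= [[ei Si] /= eb]]]; rewrite in_itv/= => /andP[bt tb].
  have [_ _ _ st] := exits_spec (open_trace oW) hq ei.
  have [f1 _ _] := exits_bij (open_trace (y0 := y0) (y1 := y1) (th := th) oW) hq.
  apply: (SB _ _ _ Si).
  - by apply: st; apply/andP; split; lra.
  - by apply: exit_point_boundary => //; exact: f1.
  - rewrite /exit_point segmB eucl_normZ.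
    apply: (@le_lt_trans _ _ (`|t - b_ i th| * 1)%R); first by rewrite ler_wpM2l.
    by rewrite mulr1 ltr_distlC; apply/andP; split; lra.
rewrite measure_semi_bigcup//; last exact: bigcup_measurable.
apply/trivIsetP => i j _ _ ij; apply/seteqP; split => // -[th t].
rewrite /before_exit/= !in_itv/= => -[[[[ei _] /= ebi] /andP[? ?]] [[[ej _] /= ebj] /andP[? ?]]].
move/eqP: ij; apply; apply: (exits_overlap (open_trace oW) hq ei ej (u := t)).
  by apply/andP; split; lra.
by apply/andP; split; lra.
Qed.

Lemma long_exits_cvg i S (e_ : R^nat) : measurable S ->
  nonincreasing_seq e_ -> e_ @ \oo --> 0%R ->
  P (long_exits i S (e_ k)) @[k --> \oo] --> P (exits_at y0 y1 W q i S).
Proof.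
move=> mS nie e0.
rewrite (_ : exits_at _ _ _ _ _ _ = \bigcup_k long_exits i S (e_ k)).
  apply: nondecreasing_cvg_mu.
  - by move=> k; exact: measurable_long_exits.
  - by apply: bigcup_measurable => k _; exact: measurable_long_exits.
  - move=> k l kl; apply/subsetPset => th [Eth /= h]; split => //=.
    exact: (le_lt_trans (nie _ _ kl) h).
apply/seteqP; split => th; last by move=> [k _ []].
move=> Eth; have [qb _ _ _] := exits_spec (open_trace oW) hq Eth.1.
have : \forall k \near \oo, (e_ k < b_ i th - q i)%R.
  by apply: (cvgr_lt _ e0); rewrite subr_gt0.
by move=> [k _ /(_ k (leqnn k)) ke]; exists k.
Qed.

(** As e decreases to 0 the long exits increase to all exits, so it suffices to
    bound the former along arbitrarily small e. *)
Lemma exit_flux_le S (C : \bar R) : measurable S -> 0 <= C ->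
  (forall e0 : R, (0 < e0)%R -> exists2 e : R, (0 < e < e0)%R &
     \sum_(i <oo) P (long_exits i S e) <= C) ->
  exit_flux P my0 my1 oW hq S <= C.
Proof.
move=> mS C0 H; rewrite exit_fluxE.
have HC k : \sum_(i <oo) P (long_exits i S (k.+1%:R^-1)) <= C.
  have [//|e /andP[e0 ek]] := H (k.+1%:R^-1)%R; apply: le_trans.
  apply: lee_nneseries => // i _; apply: le_measure; rewrite ?inE;
    try exact: measurable_long_exits.
  by move=> th [Eth /= ?]; split => //=; apply: lt_trans ek _.
apply: lime_le; first exact: is_cvg_nneseries.
apply: nearW => N.
have cvN : \sum_(0 <= i < N) P (long_exits i S (k.+1%:R^-1)) @[k --> \oo] -->
    \sum_(0 <= i < N) P (exits_at y0 y1 W q i S).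
  apply: cvg_nnesum => i _; first by apply: nearW => k; exact: measure_ge0.
  apply: (@long_exits_cvg _ _ (fun k => k.+1%:R^-1)%R) => //.
    by move=> k l kl; rewrite lef_pV2 ?posrE// ler_nat.
  exact: cvg_harmonic.
apply: (cvge_le _ cvN).
apply: nearW => k; apply: le_trans (HC k).
exact: nneseries_lim_ge.
Qed.

End layers.

(** * Inner regularity of finite Borel measures *)
Section inner_regularity.
Context {R : realType} {n : nat}.
Local Notation V := 'rV[R]_n.
Variable M : {finite_measure set V -> \bar R}.
Local Open Scope ereal_scope.

Let M_fin A : measurable A -> M A < +oo.
Proof. by move=> mA; rewrite -ge0_fin_numE//; exact: fin_num_measure. Qed.

(** Approximable in measure by closed sets from inside and by open sets from
    outside; these sets form a sigma-algebra. *)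
Definition sandwiched (A : set V) : Prop := forall e : R, (0 < e)%R ->
  exists F G, [/\ closed F, open G, F `<=` A, A `<=` G & M (G `\` F) < e%:E].

Let vanishing (A_ : (set V)^nat) (e : R) : (0 < e)%R ->
  (forall k, measurable (A_ k)) -> nonincreasing_seq A_ -> \bigcap_k A_ k = set0 ->
  exists k, M (A_ k) < e%:E.
Proof.
move=> e0 mA niA A0.
have cvA : M (A_ k) @[k --> \oo] --> M (\bigcap_k A_ k).
  apply: nonincreasing_cvg_mu => //; first exact: M_fin.
  exact: bigcapT_measurable.
rewrite A0 measure0 in cvA.
have /open_ereal_lt'/cvA[k _ /(_ k (leqnn k)) ke] : 0 < e%:E by rewrite lte_fin.
by exists k.
Qed.

Lemma sandwiched_open G : open G -> sandwiched G.
Proof.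
move=> oG e e0.
have mD k : measurable (G `\` core G k.+1%:R^-1).
  apply: measurableD; first exact: open_measurable_mx.
  by apply: closed_measurable_mx; exact: closed_core.
have [||k ke] := vanishing e0 mD.
- move=> k l kl; apply/subsetPset => x [Gx nc]; split => //.
  apply: contra_not nc => xk y xy; apply: xk; apply: le_ball xy.
  by rewrite lef_pV2 ?posrE// ler_nat.
- apply/seteqP; split => // x Gx; have [Gx0 _] := Gx 0%N Logic.I.
  have /nbhs_ballP[r /= r0 xr] : nbhs x G by exact: open_nbhs_nbhs.
  have [k _ /(_ k (leqnn k)) kr] := near_infty_natSinv_lt (PosNum r0).
  have [_ []] := Gx k Logic.I; move=> y xy; apply: xr; apply: le_ball xy.
  exact: ltW.
exists (core G k.+1%:R^-1), G; split => //; first exact: closed_core.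
by move=> x; apply; apply: ballxx; rewrite invr_gt0.
Qed.

Lemma sandwichedC A : sandwiched A -> sandwiched (~` A).
Proof.
move=> sA e /sA[F [G [cF oG FA AG GF]]]; exists (~` G), (~` F); split.
- exact: open_closedC.
- exact: closed_openC.
- exact: subsetC.
- exact: subsetC.
- by rewrite setDE setCK setIC -setDE.
Qed.

Lemma sandwiched_bigcup (A_ : (set V)^nat) :
  (forall k, sandwiched (A_ k)) -> sandwiched (\bigcup_k A_ k).
Proof.
move=> sA e e0; have e2 : (0 < e / 2)%R by rewrite divr_gt0.
have ek k : (0 < e / 2 / (2 ^ k.+1)%:R)%R by rewrite divr_gt0// ltr0n expn_gt0.
have /choice[F /choice[G FG]] : forall k, exists F G, [/\ closed F, open G,
    F `<=` A_ k, A_ k `<=` G & M (G `\` F) < (e / 2 / (2 ^ k.+1)%:R)%:E].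
  by move=> k; exact: sA.
have mG k : measurable (G k) by have [_ ? _ _ _] := FG k; exact: open_measurable_mx.
have mF k : measurable (F k) by have [? _ _ _ _] := FG k; exact: closed_measurable_mx.
pose H N := \big[setU/set0]_(k < N) F k.
have mH N : measurable (H N) by exact: bigsetU_measurable.
have [|||N Ne] := @vanishing (fun N => \bigcup_k F k `\` H N) _ e2.
- by move=> N; apply: measurableD => //; exact: bigcupT_measurable.
- move=> k l kl; apply/subsetPset; apply: setDS; exact: subset_bigsetU.
- apply/seteqP; split => // x Fx; have [[k _ Fkx] _] := Fx 0%N Logic.I.
  have [_] := Fx k.+1 Logic.I; apply; rewrite /H -bigcup_mkord.
  by exists k => /=.
exists (H N), (\bigcup_k G k); split.
- rewrite /H -bigcup_mkord; apply: closed_bigcup => // k _.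
  by have [] := FG k.
- by apply: bigcup_open => k _; have [] := FG k.
- rewrite /H -bigcup_mkord => x [k _ Fx]; exists k => //.
  by have [_ _ + _ _] := FG k; apply.
- by apply: subset_bigcup => k _; have [] := FG k.
- have sub : \bigcup_k G k `\` H N `<=`
      \bigcup_k (G k `\` F k) `|` (\bigcup_k F k `\` H N).
    move=> x [[k _ Gx] nH]; have [Fx|nFx] := pselect (F k x).
      by right; split => //; exists k.
    by left; exists k.
  have mGF : measurable (\bigcup_k (G k `\` F k)).
    by apply: bigcupT_measurable => k; exact: measurableD.
  have mFH : measurable (\bigcup_k F k `\` H N).
    by apply: measurableD => //; exact: bigcupT_measurable.
  apply: (@le_lt_trans _ _ (M (\bigcup_k (G k `\` F k)) + M (\bigcup_k F k `\` H N))).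
    apply: le_trans (measureU2 _ _ _) => //; apply: le_measure; rewrite ?inE//.
      by apply: measurableD => //; exact: bigcupT_measurable.
    exact: measurableU.
  rewrite [e]splitr EFinD; apply: lee_ltD => //; first exact: fin_num_measure.
  apply: (@le_trans _ _ (\sum_(k <oo) M (G k `\` F k))).
    by apply: measure_sigma_subadditive => // k; exact: measurableD.
  apply: le_trans (epsilon_trick0 xpredT (ltW e2)).
  by apply: lee_nneseries => // k _; have [_ _ _ _ /ltW] := FG k.
Qed.

Lemma measurable_sandwiched A : measurable A -> sandwiched A.
Proof.
have sC : sigma_algebra setT sandwiched.
  split.
  - by apply: sandwiched_open; exact: open0.
  - by move=> B sB; rewrite setTD; exact: sandwichedC.
  - by move=> F sF; exact: sandwiched_bigcup.
move=> mA; apply: (smallest_sub sC _ mA) => B oB; exact: sandwiched_open.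
Qed.

(** A closed set given by the sandwich is cut by a large closed ball. *)
Lemma inner_regular (A : set V) (e : R) : measurable A -> (0 < e)%R ->
  exists K : set V, [/\ compact K, K `<=` A & M A <= M K + e%:E].
Proof.
move=> mA e0; have e2 : (0 < e / 2)%R by rewrite divr_gt0.
have [F [G [cF oG FA AG GF]]] := measurable_sandwiched mA e2.
have mF := closed_measurable_mx cF.
pose C (k : nat) : set V := [set x | (`|x| <= k%:R)%R].
have cC k : closed (C k).
  rewrite (_ : C k = (fun x : V => `|x|%R) @^-1` [set r | (r <= k%:R)%R])//.
  apply: closed_comp; last exact: closed_le.
  by move=> x _; exact: norm_continuous.
have mC k : measurable (C k) by exact: closed_measurable_mx.
have [|||k ke] := @vanishing (fun k => F `\` C k) _ e2.
- by move=> k; exact: measurableD.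
- move=> k l kl; apply/subsetPset; apply: setDS => x /= /le_trans; apply.
  by rewrite ler_nat.
- apply/seteqP; split => // x Fx.
  have [_] := Fx (Num.truncn `|x|).+1 Logic.I; apply => /=.
  by apply/ltW; exact: truncnS_gt.
exists (F `&` C k); split.
- apply: bounded_closed_compact; last exact: closedI.
  exists k%:R; split => // M' kM' x [_ /= /le_trans]; apply; exact: ltW.
- by move=> x [/FA].
- have sub : A `<=` (F `&` C k) `|` ((F `\` C k) `|` (G `\` F)).
    move=> x Ax; have [Fx|nF] := pselect (F x); last first.
      by right; right; split => //; exact: AG.
    by have [Cx|nC] := pselect (C k x); [left|right; left].
  have mFC := measurableI _ _ mF (mC k).
  have mFD := measurableD mF (mC k).
  have mGF := measurableD (open_measurable_mx oG) mF.
  apply: (@le_trans _ _ (M ((F `&` C k) `|` ((F `\` C k) `|` (G `\` F))))).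
    by apply: le_measure; rewrite ?inE//; apply: measurableU => //; exact: measurableU.
  apply: le_trans (measureU2 _ _ _) _ => //; first exact: measurableU.
  apply: leeD2l; apply: le_trans (measureU2 _ _ _) _ => //.
  by rewrite [e]splitr EFinD; apply: leeD; apply: ltW.
Qed.

End inner_regularity.

(** * Comparison of the exit measure with limiting measures *)
Section admissible_sets.
Local Open Scope ereal_scope.
Context {R : realType} {n : nat}.
Local Notation V := 'rV[R]_n.
Implicit Types (m : V -> R) (W : set V).

Lemma layer_integral_ge0 W (e : R) m : (0 < e)%R -> (forall x, 0 <= m x)%R ->
  0 <= layer_integral W e m.
Proof.
move=> e0 m0; apply: mule_ge0; first by rewrite lee_fin invr_ge0 ltW.
by apply: integral_ge0 => x _; rewrite lee_fin.
Qed.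

Lemma admissible_layers m W : (forall x, 0 <= m x)%R -> admissible m W ->
  exists2 C : R, (0 <= C)%R & forall e0 : R, (0 < e0)%R ->
    exists2 e : R, (0 < e < e0)%R & layer_integral W e m <= C%:E.
Proof.
move=> m0 [oW]; rewrite limf_einfE => supy.
set s := ereal_sup _ in supy.
have [C sC] : exists C : R, s < C%:E.
  move: supy; case: s => [r||]// _; last by exists 0%R; rewrite ltNyr.
  by exists (r + 1)%R; rewrite lte_fin ltrDl.
have H (e0 : R) : (0 < e0)%R -> exists2 e : R, (0 < e < e0)%R & layer_integral W e m <= C%:E.
  move=> e00.
  have : ereal_inf [set layer_integral W e m | e in `]0%R, e0[%classic] < C%:E.
    apply: le_lt_trans sC; apply: ereal_sup_ubound.
    exists (`]0%R, e0[%classic : set R) => //.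
    have : \forall e \near 0^'+, (0 < e < e0)%R.
      near=> e; apply/andP; split; first by near: e; exact: nbhs_right_gt.
      by near: e; exact: nbhs_right_lt.
    by apply: filterS => e /=; rewrite in_itv.
  by move=> /ereal_inf_lt[_ [e /= e_in <-] /ltW eC]; exists e.
exists C => //; have [e /andP[e0 _]] := H 1%R ltr01.
by rewrite -lee_fin; apply: le_trans; exact: layer_integral_ge0.
Unshelve. all: end_near. Qed.

End admissible_sets.

Section one_direction.
Local Open Scope ereal_scope.
Context {R : realType} {n : nat} {d} {Theta : measurableType d}.
Local Notation V := 'rV[R]_n.
Variable P : {finite_measure set Theta -> \bar R}.
Variables (y0 y1 : Theta -> V).
Hypotheses (my0 : measurable_fun setT y0) (my1 : measurable_fun setT y1).
Hypothesis speed1 : forall th, (eucl_norm (y1 th - y0 th) <= 1)%R.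
Variable q : R^nat.
Hypothesis hq : sampling q.
Variable m : V -> R.
Hypotheses (m0 : forall x, (0 <= m x)%R) (mm : measurable_fun setT m).
Hypothesis occm : forall B : set V, measurable B ->
  occupation P y0 y1 B <= \int[lebesgue_rV R n]_(x in B) (m x)%:E.
Variable W : set V.
Hypothesis oW : open W.

(** A test function phi that is 1 near S captures, in the layer of width e, all
    the time spent just before the long exits through S. *)
Lemma long_exits_le_layer (S B : set V) (phi : V -> R) (e : R) : (0 < e)%R ->
  measurable S -> measurable B -> measurable_fun setT phi ->
  (forall x, 0 <= phi x)%R -> (forall x, B x -> phi x = 1%R) ->
  (forall x s, S s -> (eucl_norm (x - s) < e)%R -> B x) ->
  \sum_(i <oo) P (long_exits y0 y1 W q i S e) <=
  layer_integral W e (fun x => phi x * m x)%R.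
Proof.
move=> e0 mS mB mphi phi0 phiB SB.
have mL : measurable (W `&` tube e (boundary W)).
  by apply: measurableI; apply: open_measurable_mx => //; exact: open_tube.
have := @long_exits_le_occupation _ _ _ _ P _ _ my0 my1 _ _ oW hq speed1 S
  (W `&` tube e (boundary W) `&` B) _ e0 mS (measurableI _ _ mL mB) _.
have Hs x s : W x -> S s -> boundary W s -> (eucl_norm (x - s) < e)%R ->
    (W `&` tube e (boundary W) `&` B) x.
  move=> Wx Ss bs xs; split; last exact: SB Ss xs.
  by split => //; apply/tubeP; exists s.
move/(_ Hs) => le1; rewrite /layer_integral -lee_pdivrMl; last by rewrite invr_gt0.
rewrite invrK; apply: le_trans le1 _.
apply: le_trans (occm (measurableI _ _ mL mB)) _.
have mphim : measurable_fun setT (fun x => (phi x * m x)%:E).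
  by apply/measurable_EFinP; exact: measurable_funM.
rewrite (eq_integral (fun x => (phi x * m x)%:E)); last first.
  by move=> x; rewrite inE => -[_ Bx]; rewrite phiB// mul1r.
apply: ge0_subset_integral => //.
- exact: measurableI.
- exact: measurable_funTS.
- by move=> x _; rewrite lee_fin mulr_ge0.
Qed.

(** The layer integrals bound the number of long exits, and admissibility bounds
    them along a sequence of widths tending to 0. *)
Lemma exit_flux_lty (S : set V) : measurable S -> admissible m W ->
  exit_flux P my0 my1 oW hq S < +oo.
Proof.
move=> mS /(admissible_layers m0)[C C0 HC]; apply: (@le_lt_trans _ _ C%:E); last exact: ltry.
apply: exit_flux_le => //.
move=> e0 /HC[e /andP[e1 e2] eC]; exists e; first by rewrite e1.
apply: le_trans eC.
have := @long_exits_le_layer S setT (cst 1%R) e e1 mS measurableT.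
rewrite /layer_integral; under eq_integral do rewrite mul1r.
by apply.
Qed.

(** A Urysohn function equal to 1 near K and supported in a slightly larger
    compact neighbourhood is an admissible test function for the weak-star
    convergence. The layer integrals against it dominate the exits through K,
    and the neighbourhoods shrink to K. *)
Lemma exit_flux_le_limiting_compact (nu : {measure set V -> \bar R}) (K : set V) :
  limiting_measure m W nu -> compact K -> exit_flux P my0 my1 oW hq K <= nu K.
Proof.
move=> [nufin [e_ e_cvg nulim]] cK.
have cKc : closed K by apply: compact_closed => //; exact: norm_hausdorff.
have mK := closed_measurable_mx cKc.
pose T (r : R) : set V := \bigcup_(k in K) ball k r.
have oT r : open (T r) by apply: bigcup_open => k _; exact: ball_open.
have mT r : measurable (T r) by exact: open_measurable_mx.
have Tle r r' : (r <= r')%R -> T r `<=` T r'.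
  by move=> rr' x [k Kk kx]; exists k => //; exact: le_ball kx.
have clT (r : R) : compact (closure (T r)).
  have [M [_ KM]] := compact_bounded cK.
  have KM1 x : K x -> (`|x| <= M + 1)%R by apply: KM; rewrite ltrDl.
  have TM : closure (T r) `<=` [set x | (`|x| <= M + 1 + r)%R].
    have cN : closed [set x : V | (`|x| <= M + 1 + r)%R].
      rewrite (_ : [set x | _] = (fun x : V => `|x|%R) @^-1` [set t | (t <= M + 1 + r)%R])//.
      apply: closed_comp; last exact: closed_le.
      by move=> x _; exact: norm_continuous.
    rewrite closureE => x; apply; split => // y [k Kk ky].
    rewrite /= -(subrK k y) addrC; apply: le_trans (ler_normD _ _) _.
    by apply: lerD; [exact: KM1|rewrite distrC; move: ky; rewrite -ball_normE => /ltW].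
  apply: bounded_closed_compact; last exact: closed_closure.
  exists (M + 1 + r)%R; split; first exact: num_real.
  by move=> M' HM' x /TM /= /le_trans; apply; exact: ltW.
have nuT r : nu (T r) < +oo.
  apply: le_lt_trans (nufin _ (clT r)); apply: le_measure; rewrite ?inE//.
    by apply: closed_measurable_mx; exact: closed_closure.
  exact: subset_closure.
have key (r : R) : (0 < r)%R -> exit_flux P my0 my1 oW hq K <= nu (T (r + r)%R).
  move=> r0; pose phi : V -> R := Urysohn (~` T (r + r)%R) (T r).
  have sep : uniform_separator (~` T (r + r)%R) (T r).
    apply: uniform_separatorW; exists [set xy : V * V | ball xy.1 r xy.2].
      exact: (entourage_ball _ (PosNum r0)).
    apply/seteqP; split => // -[x y] [[/= nx [k Kk ky]] xy]; apply: nx.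
    by exists k => //; apply: ball_triangle ky _; exact: ball_sym.
  have phi_cont : continuous phi by exact: Urysohn_continuous.
  have phi01 x : (0 <= phi x <= 1)%R.
    have : range phi (phi x) by exists x.
    by move=> /(@Urysohn_range _ _ _ _ _); rewrite /= in_itv.
  have phi_in x : T r x -> phi x = 1%R.
    by move=> Tx; have := @Urysohn_sub1 _ R _ _ sep (phi x); apply; exists x.
  have phi_out x : ~ T (r + r)%R x -> phi x = 0%R.
    by move=> Tx; have := @Urysohn_sub0 _ R _ _ sep (phi x); apply; exists x.
  have mphi : measurable_fun setT phi.
    apply: (measurability _ (RGenOpens.measurableE R)) => _ [_ [a [b ->]] <-].
    by rewrite setTI; apply: open_measurable_mx; apply: open_comp.
  have phi_supp : compact (closure [set x | phi x != 0%R]).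
    apply: subclosed_compact (clT (r + r)%R) _; first exact: closed_closure.
    apply: closure_subset => x /= /eqP phix; apply: contrapT => /phi_out.
    exact: phix.
  have phi_le : \int[nu]_x (phi x)%:E <= nu (T (r + r)%R).
    have -> : nu (T (r + r)%R) = \int[nu]_x (\1_(T (r + r)%R) x)%:E.
      by rewrite integral_indic ?setIT.
    apply: ge0_le_integral => //.
    - by move=> x _; rewrite lee_fin; have /andP[] := phi01 x.
    - exact/measurable_EFinP.
    - by apply/measurable_EFinP/measurable_indic.
    - move=> x _; rewrite lee_fin indicE; have [Tx|nT] := pselect (T (r + r)%R x).
        by rewrite mem_set//; have /andP[] := phi01 x.
      by rewrite phi_out.
  apply: le_trans phi_le; have phi_cvg := nulim _ phi_cont phi_supp.
  set I := \int[nu]_x (phi x)%:E in phi_cvg *.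
  have I0 : 0 <= I by apply: integral_ge0 => x _; rewrite lee_fin; have /andP[] := phi01 x.
  apply/lee_addgt0Pr => eta eta0; apply: exit_flux_le => //.
    by rewrite adde_ge0// lee_fin ltW.
  move=> e0 e00.
  have [Iy|Ify] := eqVneq I +oo.
    by rewrite Iy; exists (e0 / 2)%R; rewrite ?leey//; apply/andP; split; lra.
  have Ilt : I < I + eta%:E by rewrite lteDl ?lte_fin// ge0_fin_numE// ltey.
  have H1 : \forall k \near \oo, layer_integral W (e_ k) (fun x => phi x * m x)%R < I + eta%:E.
    exact: (phi_cvg _ (open_ereal_lt' Ilt)).
  have H2 : \forall k \near \oo, (0 < e_ k < Num.min e0 r)%R.
    have mr0 : (0 < Num.min e0 r)%R by rewrite lt_min e00.
    apply: (e_cvg [set t | (0 < t < Num.min e0 r)%R]).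
    near=> t; apply/andP; split; first by near: t; exact: nbhs_right_gt.
    by near: t; exact: nbhs_right_lt.
  have [k [k1 /andP[k2 k3]]] := @filter_ex _ \oo _ _ (filterI H1 H2).
  move: k3; rewrite lt_min => /andP[ke0 kr].
  exists (e_ k); first by rewrite k2.
  apply: le_trans (ltW k1); apply: (@long_exits_le_layer K (T r)) => //.
    by move=> x; have /andP[] := phi01 x.
  move=> x s Ks xs; exists s => //; rewrite -ball_normE /= distrC.
  by apply: le_lt_trans (mx_norm_le_eucl _) _; exact: lt_trans xs _.
pose r_ (k : nat) : R := (k.+1%:R^-1 + k.+1%:R^-1)%R.
have KT : K = \bigcap_k T (r_ k).
  apply/seteqP; split => x; first by move=> Kx k _; exists x => //; apply: ballxx; rewrite addr_gt0.
  move=> HT; apply: cKc => B /nbhs_ballP[r /= r0 xB].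
  have r2 : (0 < r / 2)%R by rewrite divr_gt0.
  have [k _ /(_ k (leqnn k)) kr] := near_infty_natSinv_lt (PosNum r2).
  have [y Ky yx] := HT k Logic.I; exists y; split => //; apply: xB.
  apply: ball_sym; apply: le_ball yx; rewrite /r_ (splitr r).
  by apply: lerD; exact: ltW.
have Tcvg : nu (T (r_ k)) @[k --> \oo] --> nu K.
  rewrite KT; apply: nonincreasing_cvg_mu => //; first exact: bigcapT_measurable.
  by move=> k l kl; apply/subsetPset; apply: Tle; apply: lerD; rewrite lef_pV2 ?posrE// ler_nat.
by apply: (cvge_ge _ Tcvg); apply: nearW => k; apply: key; rewrite invr_gt0.
Unshelve. all: end_near. Qed.

Lemma exit_flux_le_limiting (nu : {measure set V -> \bar R}) (S : set V) : measurable S ->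
  admissible m W -> limiting_measure m W nu -> exit_flux P my0 my1 oW hq S <= nu S.
Proof.
move=> mS aW lnu.
(* Restricting to the whole space only records that the measure is finite. *)
pose M : {finite_measure set V -> \bar R} :=
  @mfrestr _ V R setT (exit_flux P my0 my1 oW hq) measurableT
    (exit_flux_lty measurableT aW).
apply/lee_addgt0Pr => e e0; have [K [cK KS MS]] := inner_regular M mS e0.
have ME A : M A = exit_flux P my0 my1 oW hq A.
  by rewrite /M/= /mfrestr /mrestr setIT.
rewrite !ME in MS; apply: le_trans MS _; apply: leeD2r.
apply: le_trans (exit_flux_le_limiting_compact lnu cK) _.
apply: le_measure; rewrite ?inE//; apply: closed_measurable_mx.
by apply: compact_closed => //; exact: norm_hausdorff.
Qed.

End one_direction.

(** * The Cauchy flux of a family of random segments *)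
Section segment_flux.
Local Open Scope ereal_scope.
Context {R : realType} {n : nat} {d} {Theta : measurableType d}.
Local Notation V := 'rV[R]_n.
Variable P : {finite_measure set Theta -> \bar R}.
Variables (y0 y1 : Theta -> V).
Hypotheses (my0 : measurable_fun setT y0) (my1 : measurable_fun setT y1).
Variable q : R^nat.
Hypothesis hq : sampling q.

Definition segment_flux (W S : set V) : R :=
  if pselect (open W) is left oW then
    (fine (exit_flux P my0 my1 oW hq S) - fine (exit_flux P my1 my0 oW hq S))%R
  else 0%R.

Lemma segment_fluxE (W S : set V) (oW : open W) : segment_flux W S =
  (fine (exit_flux P my0 my1 oW hq S) - fine (exit_flux P my1 my0 oW hq S))%R.
Proof.
by rewrite /segment_flux; case: pselect.
Qed.

Hypothesis speed1 : forall th, (eucl_norm (y1 th - y0 th) <= 1)%R.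
Variable m : V -> R.
Hypotheses (m0 : forall x, (0 <= m x)%R) (mm : measurable_fun setT m).
Hypothesis occm : forall B : set V, measurable B ->
  occupation P y0 y1 B <= \int[lebesgue_rV R n]_(x in B) (m x)%:E.
Hypothesis occm' : forall B : set V, measurable B ->
  occupation P y1 y0 B <= \int[lebesgue_rV R n]_(x in B) (m x)%:E.
Variable mu : {charge set V -> \bar R}.
Hypothesis muE : forall W, open W -> mu W = P (y0 @^-1` W) - P (y1 @^-1` W).

Let speed1' th : (eucl_norm (y0 th - y1 th) <= 1)%R.
Proof. by rewrite -opprB eucl_normN. Qed.

(** The bound only needs each of the two exit measures to be at most the
    limiting measure, since the absolute value of a difference of nonnegative
    numbers is at most their maximum. The bounds on occupation say that m
    dominates the density of the expected time spent in both senses of travel.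
    *)
Theorem segment_flux_cauchy : cauchy_flux mu m segment_flux.
Proof.
have fin1 W (aW : admissible m W) (oW : open W) (S : set V) : measurable S ->
    exit_flux P my0 my1 oW hq S \is a fin_num.
  by move=> mS; rewrite ge0_fin_numE//; exact: (exit_flux_lty my0 my1 speed1 hq m0 mm occm oW).
have fin2 W (aW : admissible m W) (oW : open W) (S : set V) : measurable S ->
    exit_flux P my1 my0 oW hq S \is a fin_num.
  by move=> mS; rewrite ge0_fin_numE//; exact: (exit_flux_lty my1 my0 speed1' hq m0 mm occm' oW).
split.
- move=> U W A [oU _] [oW _] oA AUW; rewrite (segment_fluxE _ oU) (segment_fluxE _ oW).
  by congr (fine _ - fine _)%R; exact: exit_flux_local.
- move=> U S1 S2 aU mS1 _ mS2 _ S12; have [oU _] := aU.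
  rewrite !(segment_fluxE _ oU) !measureU//= !fineD; try exact: fin1; try exact: fin2.
  by rewrite opprD addrACA.
- move=> U aU; have [oU _] := aU.
  have mb := boundary_measurable U.
  rewrite (segment_fluxE _ oU) muE// EFinB !fineK; try exact: fin1; try exact: fin2.
  rewrite !exit_flux_boundary.
  have f1 := fin1 U aU oU setT measurableT; have f2 := fin2 U aU oU setT measurableT.
  have mU := open_measurable_mx oU.
  have g1 : P (y0 @^-1` U) \is a fin_num.
    by apply: fin_num_measure; rewrite -[X in measurable X]setTI; exact: my0.
  have g2 : P (y1 @^-1` U) \is a fin_num.
    by apply: fin_num_measure; rewrite -[X in measurable X]setTI; exact: my1.
  have := exit_flux_balance P my0 my1 hq oU.
  rewrite -(fineK f1) -(fineK f2) -(fineK g1) -(fineK g2) -!EFinD => -[e].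
  by congr EFin; rewrite -(fineK g1) -(fineK g2) in e *; lra.
- move=> U S nu aU mS _ lnu; have [oU _] := aU.
  have l1 := exit_flux_le_limiting my0 my1 speed1 hq m0 mm occm oU mS aU lnu.
  have l2 := exit_flux_le_limiting my1 my0 speed1' hq m0 mm occm' oU mS aU lnu.
  have f1 := fin1 U aU oU S mS; have f2 := fin2 U aU oU S mS.
  rewrite (segment_fluxE _ oU).
  have p1 : (0 <= fine (exit_flux P my0 my1 oU hq S))%R by exact: fine_ge0.
  have p2 : (0 <= fine (exit_flux P my1 my0 oU hq S))%R by exact: fine_ge0.
  move: l1 l2; rewrite -(fineK f1) -(fineK f2) /=; case: (nu S) => [r| |].
  + rewrite !lee_fin => l1 l2; rewrite ler_norml; apply/andP; split; lra.
  + by move=> *; rewrite leey.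
  + by rewrite leeNy_eq.
Qed.

End segment_flux.

(** * Uniform interior cones of Lipschitz domains *)
Section geometry.
Context {R : realType} {n : nat}.
Local Notation V := 'rV[R]_n.
Implicit Types (x w c : V) (U : set V) (Q : 'M[R]_n).

Lemma mulmx_lipschitz Q : exists2 C : R, 0 <= C & forall w, `|w *m Q| <= C * `|w|.
Proof.
exists (\sum_(j < n) \sum_(k < n) `|Q k j|).
  by apply: sumr_ge0 => j _; exact: sumr_ge0.
move=> w; have C0 : 0 <= \sum_(j < n) \sum_(k < n) `|Q k j|.
  by apply: sumr_ge0 => j _; exact: sumr_ge0.
apply: mx_norm_le => [|j]; first exact: mulr_ge0.
rewrite mxE; apply: le_trans (ler_norm_sum _ _ _) _.
apply: (@le_trans _ _ (\sum_k `|Q k j| * `|w|)).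
  by apply: ler_sum => k _; rewrite normrM mulrC ler_wpM2l// coord_le_mx_norm.
rewrite -mulr_suml ler_wpM2r// [leRHS](bigD1 j)//= lerDl.
by apply: sumr_ge0 => k _; exact: sumr_ge0.
Qed.

Lemma col'_norm_le i (w : V) : `|col' i w| <= `|w|.
Proof.
by apply: mx_norm_le => // j; rewrite mxE coord_le_mx_norm.
Qed.

Definition cone_at U (c : V) (rho : R) (x : V) : Prop :=
  forall w t, `|w| < rho -> 0 < t <= 1 -> U (x + t *: (c + w)).

Lemma cone_atW U c (rho rho' : R) x : rho' <= rho -> cone_at U c rho x -> cone_at U c rho' x.
Proof. by move=> rr cU w t wr; apply: cU; exact: lt_le_trans rr. Qed.

(** Near a boundary point the domain is the set where the height h above the
    graph is positive. The function h is Lipschitz, nonnegative on the boundary,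
    and grows at unit rate in the vertical direction v, so a thin cone around v
    stays inside. The bound on the size of the cone makes all its vectors of
    Euclidean length at most 1. *)
Lemma lipschitz_cone U p : bounded_lipschitz_domain U -> boundary U p ->
  exists c (rho r : R), [/\ 0 < rho, 0 < r, n%:R * (`|c| + rho) <= 1 &
    forall x, boundary U x -> ball p r x -> cone_at U c rho x].
Proof.
move=> [oU _ lipU] /lipU[Q [i [g [r0 [QQ [L [_ lipg]] r00 chart]]]]].
pose h (y : V) : R := (y *m Q) ord0 i - g (col' i (y *m Q)).
have {}chart y : eucl_norm (y - p) < r0 -> (U y <-> 0 < h y).
  by move=> yp; rewrite (chart _ yp) subr_gt0.
have [C C0 QC] := mulmx_lipschitz Q.
have [D D0 hD] : exists2 D : R, 0 <= D & forall x y, h y <= h x + D * `|y - x|.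
  pose K := Num.max 0 (L + 1).
  have gK (a b : 'rV[R]_n.-1) : `|g a - g b| <= K * `|a - b|.
    have L1 : L < K by rewrite lt_max ltrDl ltr01 orbT.
    exact: (lipg K L1 (a, b)).
  have K0 : 0 <= K by rewrite le_max lexx.
  exists (C + K * C); first by rewrite addr_ge0// mulr_ge0.
  move=> x y; rewrite /h.
  have e1 : `|(y *m Q) ord0 i - (x *m Q) ord0 i| <= C * `|y - x|.
    apply: le_trans (QC _); rewrite mulmxBl.
    by have := coord_le_mx_norm (y *m Q - x *m Q) i; rewrite !mxE.
  have e2 : `|g (col' i (y *m Q)) - g (col' i (x *m Q))| <= K * (C * `|y - x|).
    apply: le_trans (gK _ _) _; rewrite ler_wpM2l//.
    apply: le_trans (QC _); rewrite mulmxBl.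
    apply: le_trans (col'_norm_le i _); rewrite le_eqVlt; apply/orP; left.
    by apply/eqP; congr `|_|; apply/rowP => j; rewrite !mxE.
  move: e1 e2; rewrite !ler_norml => /andP[_ e1] /andP[e2 _].
  by rewrite mulrDl -mulrA; lra.
(* v is the vertical unit vector, expressed in the original coordinates. *)
pose v : V := delta_mx ord0 i *m Q^T.
have vQ : v *m Q = delta_mx ord0 i by rewrite /v -mulmxA (mulmx1C QQ) mulmx1.
have hv y t : h (y + t *: v) = h y + t.
  rewrite /h mulmxDl -scalemxAl vQ !mxE !eqxx mulr1 addrAC; congr (_ - g _ + _).
  by apply/rowP => j; rewrite !mxE (eq_sym (lift i j)) (negbTE (neq_lift i j)) andbF mulr0 addr0.
(* Three lengths at most a add up, in Euclidean norm, to less than r0 and 1. *)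
pose a : R := Num.min r0 1 / (4 * n.+1%:R).
have n0 : 0 < n.+1%:R :> R by [].
have m0 : 0 < Num.min r0 1 by rewrite lt_min r00 ltr01.
have a0 : 0 < a by rewrite divr_gt0// mulr_gt0.
pose s := a / (`|v| + 1).
have v1 : 0 < `|v| + 1 by rewrite ltr_wpDl.
have s0 : 0 < s by rewrite divr_gt0.
have sv : s * `|v| <= a.
  by rewrite /s mulrAC ler_pdivrMr// ler_pM2l// lerDl.
pose rho := Num.min a (s / (D + 1)).
have D1 : 0 < D + 1 by rewrite ltr_wpDl.
have rho0 : 0 < rho by rewrite lt_min a0 divr_gt0.
have rhoa : rho <= a by rewrite ge_min lexx.
have rhos : rho * (D + 1) <= s by rewrite -ler_pdivlMr// ge_min lexx orbT.
have na : n%:R * (a + a + a) < Num.min r0 1.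
  have nn : n%:R < n.+1%:R :> R by rewrite ltr_nat.
  have aE : a * (4 * n.+1%:R) = Num.min r0 1 by rewrite /a divfK// gt_eqF// mulr_gt0.
  have na0 : 0 <= n%:R * a by rewrite mulr_ge0// ltW.
  by rewrite -aE -natr1; lra.
have near_p y : `|y - p| <= a + a + a -> eucl_norm (y - p) < r0.
  move=> ya; apply: le_lt_trans (eucl_norm_le_mx _) _.
  apply: lt_le_trans (_ : Num.min r0 1 <= r0); last by rewrite ge_min lexx.
  by apply: le_lt_trans na; rewrite ler_wpM2l.
have hb x : boundary U x -> `|x - p| < a -> 0 <= h x.
  move=> [cx _] xpn; rewrite leNgt; apply/negP => hx.
  pose e := Num.min a (- h x / (D + 1)).
  have e0 : 0 < e by rewrite lt_min a0 divr_gt0// oppr_gt0.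
  have [y [Uy]] := cx _ (nbhsx_ballx x e e0).
  rewrite -ball_normE /= distrC lt_min => /andP[yxa yxD].
  have /near_p/chart[/(_ Uy) + _] : `|y - p| <= a + a + a.
    rewrite -(subrK x y) -addrA; apply: le_trans (ler_normD _ _) _; lra.
  move: yxD; rewrite ltr_pdivlMr// => yxD.
  by have := hD x y; have := normr_ge0 (y - x); lra.
exists (s *: v), rho, a; split => //.
  apply: ltW; apply: lt_le_trans (_ : Num.min r0 1 <= 1); last by rewrite ge_min lexx orbT.
  apply: le_lt_trans na; rewrite ler_wpM2l// normrZ gtr0_norm//; lra.
move=> x bx px w t wrho /andP[t0 t1].
have xpn : `|x - p| < a by move: px; rewrite -ball_normE /= distrC.
have tsw : `|t *: (s *: v + w)| <= a + a.
  rewrite normrZ gtr0_norm//; apply: (@le_trans _ _ (1 * `|s *: v + w|)).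
    by rewrite ler_wpM2r.
  rewrite mul1r; apply: le_trans (ler_normD _ _) _; rewrite normrZ gtr0_norm//.
  by apply: lerD => //; apply: le_trans rhoa; exact: ltW.
apply/chart.
  apply: near_p; rewrite addrAC; apply: le_trans (ler_normD _ _) _.
  by rewrite -addrA; apply: lerD => //; exact: ltW.
have -> : x + t *: (s *: v + w) = (x + t *: w) + (t * s) *: v.
  by rewrite scalerDr scalerA addrA addrAC.
rewrite hv; have := hD (x + t *: w) x; have := hb x bx xpn.
rewrite opprD addNKr normrN normrZ gtr0_norm// => hx0 hle.
have : t * (D * `|w|) < t * s.
  rewrite ltr_pM2l//; apply: le_lt_trans (_ : D * rho < _); first by rewrite ler_wpM2l// ltW.
  by move: rhos; rewrite mulrDr mulr1 mulrC; lra.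
by rewrite mulrCA => ?; lra.
Qed.

Lemma compact_boundary U : bounded_set U -> compact (boundary U).
Proof.
move=> [M [Mr UM]]; have cB : closed (boundary U).
  rewrite /boundary setDE; apply: closedI; first exact: closed_closure.
  by apply: open_closedC; exact: open_interior.
apply: bounded_closed_compact => //.
exists M; split => // M' /UM {}UM x [cx _].
have cN : closed [set y : V | `|y| <= M'].
  rewrite (_ : [set y | _] = (fun y : V => `|y|) @^-1` [set t | t <= M'])//.
  apply: closed_comp; last exact: closed_le.
  by move=> y _; exact: norm_continuous.
by move: cx; rewrite closureE => /(_ [set y : V | `|y| <= M']); apply.
Qed.

(** The direction of the cone is chosen by the first ball of the list that
    contains the point, hence in a measurable way. *)
Lemma finite_cones U (s : seq V) (r : V -> R) :
  (forall p, p \in s -> exists c (rho : R), [/\ 0 < rho, n%:R * (`|c| + rho) <= 1 &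
    forall x, boundary U x -> ball p (r p) x -> cone_at U c rho x]) ->
  exists (c : V -> V) (rho : R), [/\ measurable_fun setT c, 0 < rho,
    forall x, n%:R * (`|c x| + rho) <= 1 &
    forall x p, p \in s -> boundary U x -> ball p (r p) x -> cone_at U (c x) rho x].
Proof.
elim: s => [_|p s IH Hs].
  exists (cst 0), (n.+1%:R^-1); split => //.
  by move=> x; rewrite normr0 add0r ler_pdivrMr// mul1r ler_nat.
have [|c [rho [mc rho0 crho Hc]]] := IH.
  by move=> p' ps; apply: Hs; rewrite inE ps orbT.
have [|c0 [rho' [rho'0 crho' Hc']]] := Hs p; first by rewrite inE eqxx.
pose c1 x := c x + \1_(ball p (r p)) x *: (c0 - c x).
have c1E x : c1 x = if x \in (ball p (r p) : set V) then c0 else c x.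
  rewrite /c1 indicE; case: ifPn => _; last by rewrite scale0r addr0.
  by rewrite scale1r addrC subrK.
exists c1, (Num.min rho rho'); split.
- apply: measurable_fun_rV => i.
  rewrite (_ : (fun x => _) = (fun x => c x ord0 i +
      \1_(ball p (r p)) x * (c0 ord0 i - c x ord0 i))); last first.
    by apply/funext => x; rewrite /c1 !mxE.
  have mci : measurable_fun setT (fun x => c x ord0 i) by exact: measurable_fun_coord.
  apply: measurable_funD => //; apply: measurable_funM.
    by apply: measurable_indic; apply: open_measurable_mx; exact: ball_open.
  exact: measurable_funB.
- by rewrite lt_min rho0.
- move=> x; rewrite c1E; case: ifPn => _.
    by apply: le_trans crho'; rewrite ler_wpM2l// lerD2l ge_min lexx orbT.
  by apply: le_trans (crho x); rewrite ler_wpM2l// lerD2l ge_min lexx.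
- move=> x p' ps bx px; rewrite c1E; case: ifPn => [|nx].
    rewrite inE => /(Hc' x bx); apply: cone_atW.
    by rewrite ge_min lexx orbT.
  move: ps px; rewrite inE => /predU1P[->|ps px].
    by rewrite notin_setE in nx.
  by apply: cone_atW (Hc _ _ ps bx px); rewrite ge_min lexx.
Qed.

(** Compactness of the boundary makes the opening of the cones uniform. *)
Lemma uniform_cones U : bounded_lipschitz_domain U ->
  exists (c : V -> V) (rho : R), [/\ measurable_fun setT c, 0 < rho,
    forall x, n%:R * (`|c x| + rho) <= 1 &
    forall x, boundary U x -> cone_at U (c x) rho x].
Proof.
move=> lipU; have [_ bU _] := lipU.
have /choice[r Hr] : forall p, exists r : R, boundary U p -> 0 < r /\
    exists c (rho : R), [/\ 0 < rho, n%:R * (`|c| + rho) <= 1 &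
      forall x, boundary U x -> ball p r x -> cone_at U c rho x].
  move=> p; have [bp|nbp] := pselect (boundary U p); last by exists 0.
  have [c [rho [r [rho0 r0 crho H]]]] := lipschitz_cone lipU bp.
  by exists r => _; split => //; exists c, rho.
have := compact_boundary bU; rewrite compact_cover.
move=> /(_ V (boundary U) (fun p => ball p (r p))) [].
- by move=> p _; exact: ball_open.
- by move=> x bx; exists x => //; apply: ballxx; have [] := Hr x bx.
move=> D DU cov; have [|c [rho [mc rho0 crho Hc]]] := @finite_cones U (finmap.enum_fset D) r.
  by move=> p pD; have [_] := Hr p (set_mem (DU _ pD)).
exists c, rho; split => // x bx.
by have [p pD px] := cov x bx; exact: (Hc x p).
Qed.

End geometry.

(** * Homotheties and Lebesgue null sets *)
Section affine_null.
Local Open Scope ereal_scope.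
Context {R : realType}.
Local Notation TR := (measurableTypeR R).

Let affine (a t : R) : TR -> TR := fun u => (a + t * u)%R.

Let measurable_affine a t : measurable_fun setT (affine a t).
Proof.
have : measurable_fun setT (fun u : R => a + t * u)%R.
  by apply: measurable_funD => //; exact: measurable_funM.
exact.
Qed.

Let pushed (a t : R) : {measure set TR -> \bar R} :=
  measure_function_pushforward__canonical__measure_function_Measure
    lebesgue_measure (measurable_affine a t).

Lemma lebesgue_measure_affine (a t : R) (A : set TR) : (0 < t)%R -> measurable A ->
  lebesgue_measure A = t%:E * lebesgue_measure ((fun u => a + t * u)%R @^-1` A : set TR).
Proof.
move=> t0 mA.
rewrite -[t%:E * _]/(mscale (NngNum (ltW t0)) (pushed a t) A).
apply: lebesgue_measure_unique => // X [[p q] _ <-].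
rewrite [RHS](_ : _ = t%:E * lebesgue_measure
    (`]((p - a) / t)%R, ((q - a) / t)%R]%classic : set TR)); last first.
  congr (_ * lebesgue_measure _); apply/seteqP; split => u /=; rewrite !in_itv/= /affine.
    by rewrite ltr_pdivrMr// ler_pdivlMr// mulrC => /andP[? ?]; apply/andP; split; lra.
  by rewrite ltr_pdivrMr// ler_pdivlMr// mulrC => /andP[? ?]; apply/andP; split; lra.
rewrite !lebesgue_measure_itv/= !lte_fin ltr_pM2r ?invr_gt0// ltrD2r.
case: ifPn => _; last by rewrite mule0.
rewrite -!EFinD -EFinM; congr EFin.
by rewrite -mulrBl mulrC divfK ?gt_eqF//; lra.
Qed.

(** By Fubini a null set has null slices for almost every first coordinate;
    induction handles the slices, and the one-dimensional case the exceptional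
    first coordinates. *)
Lemma lebesgue_rV_null_affine n (a : 'rV[R]_n) (t : R) (B : set 'rV[R]_n) :
  (0 < t)%R -> measurable B -> lebesgue_rV R n B = 0 ->
  lebesgue_rV R n [set w | B (a + t *: w)%R] = 0.
Proof.
move=> t0; elim: n a B => [|n IH] a B mB B0.
  suff -> : [set w | B (a + t *: w)%R] = B by [].
  by apply/seteqP; split => w /=; rewrite (_ : (a + t *: w)%R = w)//;
    apply/rowP => -[].
pose mu := lebesgue_rV R n.
pose B' : set 'rV[R]_n.+1 := [set w | B (a + t *: w)%R].
have mB' : measurable B'.
  have maff : measurable_fun setT (fun w : 'rV[R]_n.+1 => a + t *: w)%R.
    apply: measurable_fun_rV => i.
    rewrite (_ : (fun w => _) = (fun w : 'rV[R]_n.+1 => a ord0 i + t * w ord0 i)%R).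
      by apply: measurable_funD => //; apply: measurable_funM => //; exact: measurable_coord.
    by apply/funext => w; rewrite !mxE.
  by rewrite -[X in measurable X]setTI; exact: maff.
have mcons (C : set 'rV[R]_n.+1) : measurable C -> measurable (@rV_cons R n @^-1` C).
  by move=> mC; rewrite -[X in measurable X]setTI; apply: (measurable_rV_cons (n := n)).
pose E := @rV_cons R n @^-1` B; pose E' := @rV_cons R n @^-1` B'.
have mE : measurable E by exact: mcons.
have mE' : measurable E' by exact: mcons.
pose a0 := a ord0 ord0; pose a' : 'rV[R]_n := \row_j a ord0 (lift ord0 j).
have secE u : xsection E' u = [set w | xsection E (affine a0 t u) (a' + t *: w)%R].
  have consE (w : 'rV[R]_n) :
      rV_cons (affine a0 t u, (a' + t *: w)%R) = (a + t *: rV_cons (u, w))%R.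
    apply/rowP => i; case: (unliftP ord0 i) => [j|] ->; rewrite ?rV_consS ?rV_cons0.
      by rewrite [RHS]mxE [X in _ = (_ + X)%R]mxE rV_consS/= !mxE.
    by rewrite [RHS]mxE [X in _ = (_ + X)%R]mxE rV_cons0.
  by apply/seteqP; split => w; rewrite /xsection/= !inE /E' /E /B' /= consE.
pose h u := mu (xsection E u); pose h' u := mu (xsection E' u).
have mh : measurable_fun setT h by exact: measurable_fun_xsection.
have mh' : measurable_fun setT h' by exact: measurable_fun_xsection.
have h0 : \int[@lebesgue_measure R]_u `|h u| = 0.
  rewrite -[RHS]B0 [RHS]/= /lebesgue_rV_succ /pushforward/= /product_measure1.
  by apply: eq_integral => u _; rewrite gee0_abs.
pose N : set TR := h @^-1` [set~ 0].
have mN : measurable N.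
  by rewrite -[X in measurable X]setTI; apply: mh => //; exact: measurableC.
have N0 : lebesgue_measure N = 0.
  have hae := (ae_eq_integral_abs lebesgue_measure measurableT mh).1 h0.
  apply/negligibleP => //.
  by apply: negligibleS hae => u /= hu /(_ Logic.I).
pose N' : set TR := affine a0 t @^-1` N.
have mN' : measurable N'.
  by rewrite -[X in measurable X]setTI; apply: measurable_affine.
have N'0 : lebesgue_measure N' = 0.
  have /esym/eqP := lebesgue_measure_affine a0 t0 mN.
  by rewrite N0 mule_eq0 eqe gt_eqF//= => /eqP.
rewrite -[LHS]/(\int[@lebesgue_measure R]_u h' u).
rewrite (ge0_negligible_integral mN')// integral0_eq// => u [_ nN].
have hu : h (affine a0 t u) = 0 by apply: contrapT.
by rewrite /h' secE; apply: IH => //; exact: measurable_xsection.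
Qed.

End affine_null.

(** * Spreading a boundary measure over interior cones *)
Section finite_pushforward.
Local Open Scope ereal_scope.
Context d1 d2 (T1 : measurableType d1) (T2 : measurableType d2) (R : realType).
Variables (M : {finite_measure set T1 -> \bar R}) (f : T1 -> T2).
Hypothesis mf : measurable_fun setT f.

Let push : {measure set T2 -> \bar R} :=
  measure_function_pushforward__canonical__measure_function_Measure M mf.

Let push_lty : push setT < +oo.
Proof.
rewrite /push/= /pushforward preimage_setT -ge0_fin_numE//.
exact: fin_num_measure.
Qed.

Definition finite_pushforward : {finite_measure set T2 -> \bar R} :=
  mfrestr measurableT push_lty.

Lemma finite_pushforwardE A : finite_pushforward A = M (f @^-1` A).
Proof. by rewrite /finite_pushforward/= /mfrestr /mrestr setIT. Qed.

End finite_pushforward.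

Section cones_of_segments.
Local Open Scope ereal_scope.
Context {R : realType} {n : nat}.
Local Notation V := 'rV[R]_n.
Local Notation Theta := (V * V)%type.
Variables (U : set V) (c : V -> V) (r : R).
Hypotheses (oU : open U) (mc : measurable_fun setT c) (r0 : (0 < r)%R).
Hypothesis c_le : forall x, (n%:R * (`|c x| + (r + r)) <= 1)%R.
Hypothesis cones : forall x, boundary U x -> cone_at U (c x) (r + r) x.
Variable tau : {finite_measure set V -> \bar R}.

Let B0 : set V := [set w | (`|w| < r)%R].
Let D : set Theta := boundary U `*` B0.

(** The segment attached to a pair of a boundary point x and a small vector w:
    the vector c x + w of the cone at x. It is cut off to 0 for large w so that
    its length is at most 1 for all pairs. *)
Definition spoke (th : Theta) : V := (\1_B0 th.2 *: (c th.1 + th.2))%R.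

(** One end of the spoke: its interior end when x is in A, and x itself
    otherwise. For the complement of A it is the other end, so A decides in
    which sense the spoke is travelled. *)
Definition foot (A : set V) (th : Theta) : V := (th.1 + \1_A th.1 *: spoke th)%R.

Let mB0 : measurable B0.
Proof.
apply: open_measurable_mx; rewrite (_ : B0 = (fun x : V => `|x|%R) @^-1` [set t | (t < r)%R])//.
apply: open_comp; last exact: open_lt.
by move=> x _; exact: norm_continuous.
Qed.

Let mD : measurable D.
Proof. by apply: measurableX => //; exact: boundary_measurable. Qed.

Let volume_B0 : lebesgue_rV R n B0 = ((r + r) ^+ n)%:E.
Proof.
pose I_ (i : 'I_n) : set (measurableTypeR R) := `](- r)%R, r[%classic.
have -> : B0 = [set x : V | forall i, I_ i (x ord0 i)].
  apply/seteqP; split => x /= xr.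
    move=> i; rewrite /I_/= in_itv/= -ltr_norml; apply: le_lt_trans xr.
    exact: coord_le_mx_norm.
  have : (`|x| <= \big[Num.max/0]_i `|x ord0 i|)%R.
    apply: mx_norm_le => [|i]; last exact: le_bigmax.
    by elim/big_ind : _ => // a b a0 b0; rewrite le_max a0.
  move=> /le_lt_trans; apply; apply: bigmax_lt => // i _.
  by have := xr i; rewrite /I_/= in_itv/= ltr_norml.
have mI i : measurable (I_ i) by exact: measurable_itv.
rewrite (lebesgue_rV_box mI).2.
under eq_bigr do rewrite /I_ lebesgue_measure_itv/= lte_fin gtrN// -EFinB opprK.
by rewrite prodEFin prodr_const card_ord.
Qed.

Let DV : (tau \x lebesgue_rV R n) D < +oo.
Proof.
rewrite product_measure1E//; last exact: boundary_measurable.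
rewrite volume_B0 lte_mul_pinfty ?ltry//; apply: fin_num_measure.
exact: boundary_measurable.
Qed.

Let kappa_ge0 : (0 <= ((r + r) ^+ n)^-1)%R.
Proof. by rewrite invr_ge0 exprn_ge0// addr_ge0// ltW. Qed.

Let restr : {finite_measure set Theta -> \bar R} := mfrestr mD DV.

(** The apex is distributed according to tau on the boundary, and the small
    vector independently and uniformly in the ball of radius r; the factor
    normalizes the volume of this sup norm ball. *)
Definition spread : {finite_measure set Theta -> \bar R} :=
  mscale (NngNum kappa_ge0) restr.

Let spreadE C : spread C = (((r + r) ^+ n)^-1)%:E * (tau \x lebesgue_rV R n) (C `&` D).
Proof. by []. Qed.

Let spread_off : spread (~` D) = 0.
Proof. by rewrite spreadE setICl measure0 mule0. Qed.

Let spread_fst S : measurable S -> spread (fst @^-1` S) = tau (S `&` boundary U).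
Proof.
move=> mS; rewrite spreadE (_ : _ `&` D = (S `&` boundary U) `*` B0).
  rewrite product_measure1E//; last by apply: measurableI => //; exact: boundary_measurable.
  by rewrite volume_B0 muleCA -EFinM mulVf ?mule1// expf_neq0// gt_eqF// addr_gt0//.
by apply/seteqP; split => -[x w] /= [] => [? []|[]]; split.
Qed.

Let spokeE th : spoke th = (if th.2 \in B0 then (c th.1 + th.2)%R else 0%R).
Proof. by rewrite /spoke indicE; case: ifPn => _; rewrite ?scale1r ?scale0r. Qed.

Let eucl_spoke th : (eucl_norm (spoke th) <= 1)%R.
Proof.
apply: le_trans (eucl_norm_le_mx _) _; rewrite spokeE; case: ifPn => [|_]; last first.
  by rewrite normr0 mulr0.
rewrite inE => wr; apply: le_trans (c_le th.1); rewrite ler_wpM2l//.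
apply: le_trans (ler_normD _ _) _; apply: lerD => //; apply: ltW.
by apply: (lt_le_trans wr); rewrite lerDl ltW.
Qed.

Lemma measurable_foot A : measurable A -> measurable_fun setT (foot A).
Proof.
move=> mA; apply: measurable_fun_rV => i.
rewrite (_ : (fun th => _) = (fun th : Theta => th.1 ord0 i +
   \1_A th.1 * (\1_B0 th.2 * (c th.1 ord0 i + th.2 ord0 i)))%R); last first.
  by apply/funext => th; rewrite !mxE.
have m1 : measurable_fun setT (fun th : Theta => th.1 ord0 i).
  by apply: measurable_fun_coord; exact: measurable_fst.
have m2 : measurable_fun setT (fun th : Theta => th.2 ord0 i).
  by apply: measurable_fun_coord; exact: measurable_snd.
have mc1 : measurable_fun setT (fun th : Theta => c th.1 ord0 i).
  by apply: measurable_fun_coord; exact: (measurableT_comp mc measurable_fst).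
have mA1 : measurable_fun setT (fun th : Theta => \1_A th.1 : R).
  exact: (measurableT_comp (measurable_indic mA) measurable_fst).
have mB1 : measurable_fun setT (fun th : Theta => \1_B0 th.2 : R).
  exact: (measurableT_comp (measurable_indic mB0) measurable_snd).
by apply: measurable_funD => //; apply: measurable_funM => //;
  apply: measurable_funM => //; exact: measurable_funD.
Qed.

Section orientation.
Local Open Scope ereal_scope.
Variables A A' : set V.
Hypotheses (mA : measurable A) (mA' : measurable A') (AA' : forall x, A' x <-> ~ A x).

Let footC th : foot A' th = (if th.1 \in A then th.1 else th.1 + spoke th)%R.
Proof.
rewrite /foot indicE; case: ifPn.
  rewrite inE => Ax; rewrite memNset ?scale0r ?addr0//.
  by move=> /AA'.
by rewrite notin_setE => /AA' Ax; rewrite mem_set// scale1r.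
Qed.

Let footE th : foot A th = (if th.1 \in A then th.1 + spoke th else th.1)%R.
Proof. by rewrite /foot indicE; case: ifPn => _; rewrite ?scale1r// scale0r addr0. Qed.

Lemma foot_speed th : (eucl_norm (foot A' th - foot A th) <= 1)%R.
Proof.
rewrite footC footE; case: ifPn => _.
  by rewrite opprD addNKr eucl_normN eucl_spoke.
by rewrite addrAC subrr add0r eucl_spoke.
Qed.

(** Time elapsed since the apex or left until it, according to the sense of
    travel. *)
Let clock (th : Theta) (t : R) : R := if th.1 \in A then (1 - t)%R else t.

Let segm_foot th t : segm (foot A) (foot A') th t = (th.1 + clock th t *: spoke th)%R.
Proof.
rewrite /segm footC footE /clock; case: ifPn => _; apply/rowP => i; rewrite !mxE; ring.
Qed.

Let mfoot := measurable_foot mA.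
Let mfoot' := measurable_foot mA'.

Let msegm_pre (B : set V) : measurable B -> measurable
  ((fun z : Theta * measurableTypeR R => segm (foot A) (foot A') z.1 z.2) @^-1` B).
Proof.
by move=> mB; rewrite -[X in measurable X]setTI; apply: measurable_segm2.
Qed.

(** At a fixed time strictly between 0 and 1, and for a fixed apex, the position
    is a nondegenerate homothetic image of the uniform vector, so that a null
    set is almost never visited. *)
Lemma occupation_null (B : set V) : measurable B -> lebesgue_rV R n B = 0 ->
  occupation spread (foot A) (foot A') B = 0.
Proof.
move=> mB LB; rewrite /occupation; set E := _ @^-1` _.
have mE : measurable E by exact: msegm_pre.
rewrite (@product_measure_unique _ _ _ _ _ spread unit_time
  (spread \x^ unit_time) _ E mE); last first.
  by move=> *; exact: product_measure2E.
(* At times 0 and 1 the position may be the apex, which does not depend on w. *)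
pose N : set (measurableTypeR R) := ~` `]0%R, 1%R[%classic.
have mN : measurable N by apply: measurableC; exact: measurable_itv.
have N0 : unit_time N = 0.
  rewrite unit_timeE; apply: countable_lebesgue_measure0.
  apply: (@sub_countable _ _ _ [set 0%R; 1%R]); last exact: finite_set_countable.
  apply: subset_card_le => t [nt]; rewrite /= in_itv/= => /andP[t0 t1].
  have [->|tn0] := eqVneq t 0%R; first by left.
  have [->|tn1] := eqVneq t 1%R; first by right.
  by exfalso; apply: nt; rewrite /= in_itv/= !lt_neqAle t0 t1 eq_sym tn0 tn1.
rewrite [LHS]/= /product_measure2 (ge0_negligible_integral mN)//; last first.
  exact: measurable_fun_ysection.
apply: integral0_eq => t [_ /contrapT]; rewrite /= in_itv/= => /andP[t0 t1].
rewrite /comp spreadE (_ : (_ \x _) _ = 0) ?mule0//.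
rewrite /product_measure1; apply: integral0_eq => x _.
have clock0 : (0 < clock (x, 0) t)%R by rewrite /clock; case: ifPn => _ //; rewrite subr_gt0.
have := lebesgue_rV_null_affine (x + clock (x, 0%R) t *: c x)%R clock0 mB LB.
apply: subset_measure0.
- by apply: measurable_xsection; apply: measurableI => //; exact: measurable_ysection.
- have maff : measurable_fun setT
      (fun w : V => x + clock (x, 0%R) t *: c x + clock (x, 0%R) t *: w)%R.
    apply: measurable_fun_rV => i.
    rewrite (_ : (fun w => _) = (fun w : V => (x + clock (x, 0%R) t *: c x) ord0 i
        + clock (x, 0%R) t * w ord0 i)%R).
      by apply: measurable_funD => //; apply: measurable_funM => //; exact: measurable_coord.
    by apply/funext => w; rewrite !mxE.
  by rewrite -[X in measurable X]setTI; exact: maff.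
- move=> w; rewrite /xsection/= inE => -[]; rewrite /ysection/= inE /E/= segm_foot.
  move=> + [_ /= wB]; rewrite spokeE mem_set//=.
  by rewrite scalerDr addrA.
Qed.

Let deep x w t y (e : R) : boundary U x -> (`|w| < r)%R -> (0 <= t <= 1)%R ->
  boundary U y -> (eucl_norm (x + t *: (c x + w) - y) < e)%R -> (t < e / r)%R.
Proof.
move=> bx wr /andP[t0 t1] bY xye; rewrite ltNge; apply/negP => et.
have e0 : (0 < e)%R by apply: le_lt_trans xye; exact: eucl_norm_ge0.
have tp : (0 < t)%R by apply: lt_le_trans et; rewrite divr_gt0.
(* Moving w to w' moves the position at time t to y. *)
pose w' := (w + t^-1 *: (y - (x + t *: (c x + w))))%R.
have w'r : (`|w'| < r + r)%R.
  apply: le_lt_trans (ler_normD _ _) _; apply: ltrD => //.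
  rewrite normrZ gtr0_norm ?invr_gt0// mulrC ltr_pdivrMr//.
  rewrite distrC; apply: le_lt_trans (mx_norm_le_eucl _) _.
  by apply: lt_le_trans xye _; rewrite mulrC -ler_pdivrMr.
have := cones bx w'r; rewrite -/w' => /(_ t); rewrite tp t1 => /(_ isT).
rewrite /w' addrA scalerDr scalerA mulfV ?gt_eqF// scale1r addrA addrC subrK.
exact: boundary_nmem.
Qed.

(** The spokes leave the boundary transversally: at time t from the apex they
    are at distance at least r t from it, because a ball of radius r t around
    the position still lies in the cone. So they spend a time at most e / r in
    the tube. *)
Lemma occupation_layer (e : R) : (0 < e)%R ->
  occupation spread (foot A) (foot A') (tube e (boundary U)) <= (e / r)%:E * spread setT.
Proof.
move=> e0; rewrite /occupation /product_measure1.
have mT : measurable (tube e (boundary U)) by apply: open_measurable_mx; exact: open_tube.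
rewrite (ge0_negligible_integral (measurableC mD) measurableT _ _ spread_off)//; last first.
  by apply: measurable_fun_xsection; exact: msegm_pre.
rewrite setDE setCK setTI -integral_cst//.
apply: (@le_trans _ _ (\int[spread]_(th in D) (e / r)%:E)); last first.
  apply: ge0_subset_integral => //.
  by move=> th _; rewrite lee_fin divr_ge0// ltW.
apply: ge0_le_integral => //.
- by apply: measurable_funTS; apply: measurable_fun_xsection; exact: msegm_pre.
- move=> [x w] [/= bx wr]; rewrite unit_timeE.
  have key t : xsection ((fun z : Theta * measurableTypeR R =>
      segm (foot A) (foot A') z.1 z.2) @^-1` tube e (boundary U)) (x, w) t ->
      (0 <= t <= 1)%R -> (clock (x, w) t < e / r)%R.
    rewrite /xsection/= inE/= segm_foot => /tubeP[y bY +] t01.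
    rewrite spokeE mem_set//= => /(deep bx wr _ bY); apply.
    by rewrite /clock; case: ifPn => _ //; lra.
  have er : (0 < e / r)%R by rewrite divr_gt0.
  have mX := measurable_xsection (x, w) (msegm_pre mT).
  apply: (@le_trans _ _ (lebesgue_measure (if x \in A
      then `](1 - e / r)%R, 1%R]%classic
      else `[0%R, (e / r)%R[%classic : set (measurableTypeR R)))).
    apply: le_measure; rewrite ?inE.
    + by apply: measurableI => //; exact: measurable_itv.
    + by case: ifPn => _; exact: measurable_itv.
    + move=> t [/key + t01]; move: t01; rewrite /= in_itv/= => t01 /(_ t01).
      by rewrite /clock/=; case: ifPn => _; rewrite /= in_itv/= => ?; lra.
  case: ifPn => _; rewrite lebesgue_measure_itv/= lte_fin.
    by rewrite gtrBl er -EFinB lee_fin; lra.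
  by rewrite er -EFinB subr0.
Qed.

Let exit_set_in th : D th -> th.1 \in A ->
  exit_set (trace (foot A) (foot A') U th) = [set 1%R].
Proof.
move=> [/= bx wr] xA; have tr t : (0 <= t < 1)%R -> trace (foot A) (foot A') U th t.
  move=> t01; rewrite /trace/= segm_foot /clock xA spokeE mem_set//.
  by apply: (cones bx); [apply: (lt_trans wr); rewrite ltrDl|lra].
apply/seteqP; split => [b [/andP[b0 b1] nb _]|_ ->].
  apply/eqP; rewrite eq_le b1/= leNgt; apply/negP => bl; apply: nb; apply: tr.
  by rewrite ltW.
split; rewrite ?ltr01 ?lexx//.
  rewrite /trace/= segm_foot /clock xA subrr scale0r addr0.
  exact: boundary_nmem.
by exists 0%R => // u /andP[? ?]; apply: tr; rewrite ltW.
Qed.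

Let exit_set_out th : D th -> th.1 \notin A ->
  exit_set (trace (foot A) (foot A') U th) = set0.
Proof.
move=> [/= bx wr] xA; apply/seteqP; split => // b [b01 nb _]; apply: nb.
rewrite /trace/= segm_foot /clock (negbTE xA) spokeE mem_set//.
by apply: (cones bx) => //; apply: (lt_trans wr); rewrite ltrDl.
Qed.

(** Spokes with apex in A end there, coming from inside U, and have no other
    exit; the others start at their apex and never exit. *)
Lemma exit_flux_cones q (hq : sampling q) S : measurable S ->
  exit_flux spread mfoot mfoot' oU hq S = tau (A `&` S `&` boundary U).
Proof.
move=> mS; have mAS := measurableI _ _ mA mS.
rewrite -spread_fst// exit_flux_integral//.
have mpre : measurable (fst @^-1` (A `&` S) : set Theta).
  by rewrite -[X in measurable X]setTI; exact: measurable_fst.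
have -> : spread (fst @^-1` (A `&` S)) =
    \int[spread]_th (\1_(fst @^-1` (A `&` S)) th)%:E.
  by rewrite integral_indic ?setIT.
have mnb := measurable_nb_exits mfoot mfoot' oU hq mS.
rewrite (ge0_negligible_integral (measurableC mD) measurableT mnb _ spread_off); last first.
  by move=> th _; exact: esum_ge0.
rewrite [RHS](ge0_negligible_integral (measurableC mD) measurableT _ _ spread_off); last 2 first.
- by apply/measurable_EFinP; exact: measurable_indic.
- by move=> th _; rewrite lee_fin.
apply: eq_integral => th; rewrite setDE setCK setTI inE => Dth.
rewrite /nb_exits indicE; have [xA|xA] := boolP (th.1 \in A); last first.
  rewrite exit_set_out// set0I esum_set0 memNset//.
  by move=> [Ax _]; rewrite notin_setE in xA.
rewrite exit_set_in//; have s1 : segm (foot A) (foot A') th 1 = th.1.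
  by rewrite segm_foot /clock xA subrr scale0r addr0.
have [Sx|nSx] := pselect (S th.1).
  rewrite mem_set; last by split => //; rewrite inE in xA.
  rewrite (_ : _ `&` _ = [set 1%R]) ?esum_set1//.
  by apply/seteqP; split => [t []//|_ ->]; split => //=; rewrite s1.
rewrite memNset; last by move=> [].
rewrite (_ : _ `&` _ = set0) ?esum_set0//.
by apply/seteqP; split => // t [->]; rewrite /= s1.
Qed.

End orientation.

End cones_of_segments.

(** * Existence of the flux *)
Section occupation_density.
Local Open Scope ereal_scope.
Context {R : realType} {n : nat} {d} {Theta : measurableType d}.
Local Notation V := 'rV[R]_n.
Variable P : {finite_measure set Theta -> \bar R}.
Variables (y0 y1 : Theta -> V).
Hypotheses (my0 : measurable_fun setT y0) (my1 : measurable_fun setT y1).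

Let push : {measure set V -> \bar R} :=
  measure_function_pushforward__canonical__measure_function_Measure
    (P \x unit_time) (measurable_segm2 my0 my1).

Let push_lty : push setT < +oo.
Proof.
rewrite /push/= /pushforward preimage_setT -setXTT product_measure1E//.
by rewrite lte_mul_pinfty ?measure_ge0 -?ge0_fin_numE//; exact: fin_num_measure.
Qed.

Let occupation_measure : {finite_measure set V -> \bar R} :=
  mfrestr measurableT push_lty.

Let occupation_measureE B : occupation_measure B = occupation P y0 y1 B.
Proof. by rewrite /occupation_measure/= /mfrestr /mrestr setIT. Qed.

(** The Radon-Nikodym theorem for the occupation measure, which is finite
    because time runs in the unit interval. *)
Lemma occupation_density :
  (forall B, measurable B -> lebesgue_rV R n B = 0 -> occupation P y0 y1 B = 0) ->
  exists f : V -> R, [/\ forall x, (0 <= f x)%R,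
    (lebesgue_rV R n).-integrable setT (EFin \o f) &
    forall B, measurable B ->
      occupation P y0 y1 B = \int[lebesgue_rV R n]_(x in B) (f x)%:E].
Proof.
move=> occ0.
have dom : occupation_measure `<< lebesgue_rV R n.
  apply/null_content_dominatesP => B mB B0.
  by rewrite occupation_measureE; exact: occ0.
have [f [f0 ffin fint fE]] := radon_nikodym_sigma_finite dom.
exists (fun x => fine (f x)); split.
- by move=> x; exact: fine_ge0.
- by apply: eq_integrable fint => // x _; rewrite /= fineK.
- move=> B mB; rewrite -occupation_measureE fE//.
  by apply: eq_integral => x _; rewrite fineK.
Qed.

End occupation_density.

Section variation.
Local Open Scope ereal_scope.
Context {R : realType} {n : nat}.
Local Notation V := 'rV[R]_n.
Variable sigma : {charge set V -> \bar R}.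

(** Take for A a Hahn set of sigma and for tau its total variation. *)
Lemma signed_split : exists (A : set V) (tau : {finite_measure set V -> \bar R}),
  measurable A /\ forall S, measurable S ->
    sigma S = tau (A `&` S) - tau (~` A `&` S).
Proof.
have [A [N AN]] := Hahn_decomposition sigma.
have [[mA _] [mN _] ANT AN0] := AN.
have lty : charge_variation AN setT < +oo.
  by rewrite -ge0_fin_numE//; exact: (fin_num_measure (charge_variation AN)).
exists A, (mfrestr measurableT lty); split => // S mS.
have mAS := measurableI _ _ mA mS; have mCS := measurableI _ _ (measurableC mA) mS.
rewrite /= /mfrestr /mrestr !setIT /charge_variation/=.
rewrite (jordan_decomp AN mS) /cadd/= cscaleN1.
rewrite !jordan_posE !jordan_negE !cjordan_posE !cjordan_negE /crestr0.
rewrite !mem_set// /crestr.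
have NC x : N x -> ~ A x by move=> Nx Ax; have : (A `&` N) x by []; rewrite AN0.
rewrite (_ : A `&` S `&` A = S `&` A); last first.
  by apply/seteqP; split => x /=; tauto.
rewrite (_ : A `&` S `&` N = set0); last first.
  by apply/seteqP; split => x //= [[Ax _] /NC].
rewrite (_ : ~` A `&` S `&` A = set0); last first.
  by apply/seteqP; split => x //= [[]].
rewrite (_ : ~` A `&` S `&` N = S `&` N); last first.
  by apply/seteqP; split => [x [[_ ?] ?]|x [Sx Nx]] //; split => //; split => //; exact: NC.
by rewrite charge0 oppe0 adde0 add0e.
Qed.

End variation.

Section existence.
Context {R : realType} {n : nat}.
Local Notation V := 'rV[R]_n.
Local Open Scope ereal_scope.

Lemma le_limf_einf (f : R -> \bar R) (C : \bar R) :
  (forall e, (0 < e)%R -> f e <= C) -> limf_einf f 0^'+ <= C.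
Proof.
move=> fC; rewrite limf_einfE; apply: ge_ereal_sup => _ [I FI <-].
have [e [/= e0 Ie]] : exists e : R, (0 < e)%R /\ I e.
  have FI2 : \forall e \near (0^'+ : set_system R), (0 < e)%R /\ I e.
    by apply: filterI => //; exact: nbhs_right_gt.
  by have [e He] := @filter_ex _ (0^'+ : set_system R) _ _ FI2; exists e.
by apply: le_trans (fC e e0); apply: ereal_inf_lbound; exists e.
Qed.

(** The spokes with apex in the Hahn set A are travelled towards the boundary, the
    others away from it, with mass given by the total variation tau. The exits from
    U then happen on A with law tau and the entrances on the complement of A, so
    the flux through S is tau on A minus tau on the complement, that is sigma. *)
Lemma exists_flux_with_trace (U : set V) (sigma : {charge set V -> \bar R}) :
  bounded_lipschitz_domain U ->
  exists (mu : {charge set V -> \bar R}) (m : V -> R) (F : set V -> set V -> R),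
    [/\ forall x, (0 <= m x)%R,
        (lebesgue_rV R n).-integrable setT (EFin \o m),
        cauchy_flux mu m F,
        admissible m U &
        forall S, measurable S -> S `<=` boundary U -> (F U S)%:E = sigma S].
Proof.
move=> hU; have [oU _ _] := hU.
have [c [rho [mc rho0 c_le cones]]] := uniform_cones hU.
have [A [tau [mA sigmaE]]] := signed_split sigma.
have mA' := measurableC mA.
have [q hq] := @sampling_exists R.
pose r : R := (rho / 2)%R.
have r0 : (0 < r)%R by rewrite divr_gt0.
have rr : (r + r = rho)%R by rewrite -splitr.
rewrite -rr in c_le cones.
pose P := spread U r0 tau.
pose y0 := foot c r A; pose y1 := foot c r (~` A).
pose my0 : measurable_fun setT y0 := measurable_foot r mc mA.
pose my1 : measurable_fun setT y1 := measurable_foot r mc mA'.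
have AA' x : (~` A) x <-> ~ A x by [].
have A'A x : A x <-> ~ (~` A) x by split => [? []//|/contrapT].
have [f [f0 fint fE]] := occupation_density my0 my1
  (fun B => @occupation_null R n U c r mc r0 tau A (~` A) mA mA' AA' B).
have [g [g0 gint gE]] := occupation_density my1 my0
  (fun B => @occupation_null R n U c r mc r0 tau (~` A) A mA' mA A'A B).
(* m counts the time spent twice, once for each sense of travel. *)
pose m x : R := (f x + g x)%R.
have mm0 x : (0 <= m x)%R by rewrite addr_ge0.
have mint : (lebesgue_rV R n).-integrable setT (EFin \o m).
  by rewrite (_ : EFin \o m = (EFin \o f) \+ (EFin \o g))//; exact: integrableD.
have mf : measurable_fun setT f.
  by apply/measurable_EFinP; exact: (measurable_int (lebesgue_rV R n) fint).
have mg : measurable_fun setT g.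
  by apply/measurable_EFinP; exact: (measurable_int (lebesgue_rV R n) gint).
have mm : measurable_fun setT m by exact: measurable_funD.
have mE (B : set 'rV[R]_n) : measurable B ->
    \int[lebesgue_rV R n]_(x in B) (m x)%:E = occupation P y0 y1 B + occupation P y1 y0 B.
  move=> mB; rewrite fE// gE//; under eq_integral do rewrite /m EFinD.
  apply: ge0_integralD => //; try by move=> x _; rewrite lee_fin.
    by apply/measurable_EFinP; exact: measurable_funTS.
  by apply/measurable_EFinP; exact: measurable_funTS.
pose mu0 := finite_pushforward P my0; pose mu1 := finite_pushforward P my1.
pose mu : {charge set 'rV[R]_n -> \bar R} :=
  cadd (charge_of_finite_measure mu0) (cscale (-1)%R (charge_of_finite_measure mu1)).
have muE W : open W -> mu W = P (y0 @^-1` W) - P (y1 @^-1` W).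
  by move=> oW; rewrite /mu/= /cadd/= cscaleN1 /copp/= /charge_of_finite_measure
    !finite_pushforwardE.
have occ_ge0 (z0 z1 : V * V -> V) (B : set 'rV[R]_n) : 0 <= occupation P z0 z1 B.
  exact: measure_ge0.
exists mu, m, (segment_flux P my0 my1 hq); split => //.
- apply: segment_flux_cauchy => //.
  + exact: foot_speed.
  + by move=> B mB; rewrite mE// leeDl.
  + by move=> B mB; rewrite mE// leeDr.
- split=> //; apply: (@le_lt_trans _ _ ((r^-1)%:E * P setT + (r^-1)%:E * P setT)); last first.
    have PT : (r^-1)%:E * P setT \is a fin_num by rewrite fin_numM// fin_num_measure.
    by rewrite -(fineK PT) -EFinD ltry.
  apply: le_limf_einf => e e0; rewrite /layer_integral.
  have mT : measurable (tube e (boundary U)).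
    by apply: open_measurable_mx; exact: open_tube.
  have mUT := measurableI _ _ (open_measurable_mx oU) mT.
  rewrite mE// muleDr//; last by rewrite ge0_adde_def// inE.
  have layer (z0 z1 : V * V -> V) :
      measurable_fun setT z0 -> measurable_fun setT z1 ->
      occupation P z0 z1 (tube e (boundary U)) <= (e / r)%:E * P setT ->
      (e^-1)%:E * occupation P z0 z1 (U `&` tube e (boundary U)) <= (r^-1)%:E * P setT.
    move=> mz0 mz1 le1; rewrite lee_pdivrMl// muleA -EFinM.
    apply: le_trans le1; apply: le_measure; rewrite ?inE.
    + by rewrite -[X in measurable X]setTI; exact: measurable_segm2.
    + by rewrite -[X in measurable X]setTI; exact: measurable_segm2.
    + by move=> z [].
  by apply: leeD; apply: layer => //; apply: occupation_layer.
- move=> S mS SU; rewrite (segment_fluxE _ _ _ _ _ oU).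
  have mCS := measurableI _ _ (measurableI _ _ mA mS) (boundary_measurable U).
  have mCS' := measurableI _ _ (measurableI _ _ mA' mS) (boundary_measurable U).
  have e0 : exit_flux P my0 my1 oU hq S = tau (A `&` S `&` boundary U).
    exact: (exit_flux_cones oU mc r0 cones tau mA mA' AA' hq mS).
  have e1 : exit_flux P my1 my0 oU hq S = tau (~` A `&` S `&` boundary U).
    exact: (exit_flux_cones oU mc r0 cones tau mA' mA A'A hq mS).
  rewrite e0 e1 EFinB !fineK ?fin_num_measure// sigmaE//.
  by rewrite -!setIA (setIidl SU).
Qed.

End existence.

Unset Implicit Arguments.

Theorem theorem5p10 (R : realType) (n : nat) (hn : (2 <= n)%N)
  (U : set 'rV[R]_n) (hU : bounded_lipschitz_domain U)
  (sigma : {charge set 'rV[R]_n -> \bar R})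
  (hsigma : forall S, measurable S -> S `&` boundary U = set0 ->
     sigma S = 0%E) :
  exists (mu : {charge set 'rV[R]_n -> \bar R}) (m : 'rV[R]_n -> R)
         (F : set 'rV[R]_n -> set 'rV[R]_n -> R),
    [/\ (forall x, 0 <= m x),
        (lebesgue_rV R n).-integrable setT (EFin \o m),
        cauchy_flux mu m F,
        admissible m U &
        forall S, measurable S -> S `<=` boundary U ->
          (F U S)%:E = sigma S].
Proof. exact: exists_flux_with_trace. Qed.
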